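(* The set $\mathfrak{M}:=\{m\in(1,2]:\mathcal{G}(\{0,1,m\})=1+\sqrt m\}$ is an uncountable Cantor set with Hausdorff dimension $0$.
   Context: For an alphabet (finite set of reals) $A$ with minimum $a_0$ and maximum $a_d$, and $\beta>1$: a $\beta$-expansion of $x$ over $A$ is a sequence $(u_k)_{k\ge1}\in A^{\mathbb{N}}$ with $x=\sum_{k\ge1}u_k\beta^{-k}$; $\mathcal{U}_\beta(A)$ is the set of sequences $(u_k)\in A^{\mathbb{N}}$ such that $\sum_k u_k\beta^{-k}$ has a unique $\beta$-expansion; the generalised golden ratio $\mathcal{G}(A)>1$ is the unique number such that $\mathcal{U}_\beta(A)=\{\overline{a_0},\overline{a_d}\}$ (constant sequences) for $\beta\in(1,\mathcal{G}(A))$ and $\mathcal{U}_\beta(A)$ contains another element for all $\beta>\mathcal{G}(A)$.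
   Formalization: ''Cantor set'' is taken as: closed relative to (1,2], with empty interior and no isolated points; the set accumulates at the excluded point 1, so it is not closed in the real line and not compact. *)

(* Defs.v *)
From HB Require Import structures.
From mathcomp Require Import all_boot all_order all_algebra.
From mathcomp Require Import all_classical all_reals all_analysis.
From mathcomp Require Import lra.

Set Implicit Arguments.
Unset Strict Implicit.
Unset Printing Implicit Defensive.

Import Order.TTheory GRing.Theory Num.Theory.
Import numFieldNormedType.Exports.

Local Open Scope classical_set_scope.
Local Open Scope ring_scope.

Section UniqueExpansions.
Context {R : realType}.
Implicit Types (A : set R) (b x g : R) (u : nat -> R).

(* Digits are indexed from 0, so that u k is the coefficient of b^-(k+1). *)
Definition expansion A b x u :=
  (forall k, A (u k)) /\ series (fun k => u k * b ^- k.+1) @ \oo --> x.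

Definition univoque b A : set (nat -> R) :=
  [set u | exists2 x, expansion A b x u & forall v, expansion A b x v -> v = u].

(* For a finite nonempty A, inf A and sup A are its minimum and maximum. *)
Definition trivial_sequences A : set (nat -> R) :=
  [set (fun=> inf A); (fun=> sup A)].

Definition is_golden_ratio A g :=
  [/\ 1 < g,
      forall b, 1 < b < g -> univoque b A = trivial_sequences A &
      forall b, g < b -> exists2 u, univoque b A u & ~ trivial_sequences A u].

Lemma is_golden_ratio_unique A g g' :
  is_golden_ratio A g -> is_golden_ratio A g' -> g = g'.
Proof.
wlog gg' : g g' / g < g'.
  by move=> H Hg Hg'; case: (ltgtP g g') => // h; [|symmetry]; apply: H.
move=> [g1 _ gr] [_ gl _].
have [|u] := gr ((g + g') / 2); first by lra.
by rewrite gl//; apply/andP; split; lra.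
Qed.

(* The junk value 0 is returned when no golden ratio exists; since every golden
   ratio is > 1, golden_ratio A = g with g > 1 means is_golden_ratio A g. *)
Definition golden_ratio A : R := xget 0 [set g | is_golden_ratio A g].

End UniqueExpansions.

(* M is a Cantor set in the subspace D of the line: relatively closed in D,
   with empty interior and no isolated points. Compactness is not part of the
   notion, D itself need not be closed. *)
Definition cantor_set_in {R : realType} (D M : set R) :=
  [/\ exists2 F : set R, closed F & M = D `&` F,
      M^° = set0 &
      isolated M = set0].

Section HausdorffDimension.
Context {R : realType}.
Implicit Types (E : set R) (s d : R).
Local Open Scope ereal_scope.

(* The maximum with 0 only matters for the empty set. *)
Definition diameter E : \bar R :=
  maxe 0 (ereal_sup [set `|x - y|%:E | x in E & y in E]).

Definition hausdorff_content s d E : \bar R :=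
  ereal_inf [set \sum_(0 <= i <oo) poweR (diameter (U i)) s | U in
    [set U : nat -> set R | E `<=` \bigcup_i U i /\
                            forall i, diameter (U i) <= d%:E]].

Definition hausdorff_measure s E : \bar R :=
  ereal_sup [set hausdorff_content s d E | d in [set d | (0 < d)%R]].

(* Restricting to s > 0 leaves the infimum unchanged for nonempty E and avoids
   the convention for 0 to the power 0. *)
Definition hausdorff_dimension E : \bar R :=
  ereal_inf [set s%:E | s in [set s | (0 < s)%R /\ hausdorff_measure s E = 0]].

End HausdorffDimension.

Definition frakM (R : realType) : set R :=
  [set m | 1 < m <= 2 /\
           golden_ratio [set (0 : R); 1; m] = 1 + Num.sqrt m].
Arguments frakM R : clear implicits.

(* Main.v *)
Require Import Defs.
From mathcomp Require Import all_boot all_order all_algebra.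
From mathcomp Require Import all_classical all_reals all_analysis.
From mathcomp Require Import ring lra zify.

Set Implicit Arguments.
Unset Strict Implicit.
Unset Printing Implicit Defensive.

Import Order.TTheory GRing.Theory Num.Theory.
Import numFieldNormedType.Exports.

Local Open Scope classical_set_scope.
Local Open Scope ring_scope.

(* Put c = m - 1 and b0 = 1 + sqrt m. Below base b0 a nontrivial univoque
   sequence eventually has digits in {0, 1}, and each of its tails following a
   digit 1 has a value between m / (b - 1) - 1 and c. Since m / (b - 1) - 1 >=
   c / b for b <= b0, the digit shift acts on these tails as a monotone circle
   map with a rotation number t, and comparing partial digit sums shows that
   such a sequence exists for some b < b0 if and only if, in base b0, c lies
   strictly between the values of the upper and of the lower mechanical word of
   some slope t (both without their first letter). Hence the set is the
   complement of a union of open plateaux, one for each rational slope (for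
   t = 1 there is no upper bound on c); its points are the m for which c is the value of a mechanical word. It is
   parametrized strictly monotonically by slopes, which gives uncountability
   and the Cantor property; the number of prefixes of length N of mechanical
   words is polynomial in N, whence dimension 0. *)

(** * Values of digit sequences: dependence on the digits and on the base *)

Section Values.
Context {R : realType}.
Implicit Types (b x y C : R) (d e u v : nat -> R) (n k N : nat).

Definition bterm b d k : R := d k * b ^- k.+1.
Definition bval b d : R := limn (series (bterm b d)).
Definition shift n u : nat -> R := fun k => u (n + k)%N.
Definition ocons x u : nat -> R := fun k => if k is k'.+1 then u k' else x.

Lemma shift0 u : shift 0 u = u.
Proof. by apply/funext => k; rewrite /shift add0n. Qed.

Lemma shift_shift n N u : shift n (shift N u) = shift (N + n) u.
Proof. by apply/funext => k; rewrite /shift addnA. Qed.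

Lemma shift1_ocons x u : shift 1 (ocons x u) = u.
Proof. by []. Qed.

Lemma cvg_exprV_exp b x : 1 < b -> x * b ^- n @[n --> \oo] --> (0 : R).
Proof.
move=> b1; have b0 : 0 < b by lra.
have := @cvg_geometric R x b^-1; rewrite /geometric ger0_norm ?invr_ge0 ?ltW//.
rewrite invf_lt1// => /(_ b1); under eq_fun do rewrite exprVn.
exact.
Qed.

(** Dividing the recursion by [b ^+ k.+1] turns the term of index [k] into
    [y k * b ^- k - y k.+1 * b ^- k.+1], so the partial sums telescope. *)
Lemma bterm_orbit b u (y : nat -> R) n : 0 < b ->
  (forall k, y k.+1 = b * y k - u k) ->
  series (bterm b u) n = y 0%N - y n * b ^- n.
Proof.
move=> b0 yE; elim: n => [|n IH].
  by rewrite /series/= big_geq// expr0 invr1 mulr1 subrr.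
rewrite seriesSr IH yE /bterm exprS invfM; field.
by rewrite ?expf_neq0 ?gt_eqF.
Qed.

Lemma orbit_cvg b C u (y : nat -> R) : 1 < b ->
  (forall k, y k.+1 = b * y k - u k) -> (forall k, `|y k| <= C) ->
  series (bterm b u) @ \oo --> y 0%N.
Proof.
move=> b1 yE yC; have b0 : 0 < b by lra.
have -> : series (bterm b u) = (fun n => y 0%N - y n * b ^- n).
  by apply/funext => n; apply: bterm_orbit.
rewrite -[X in _ --> X]subr0; apply: cvgB; first exact: cvg_cst.
apply/cvgr0Pnorm_le => e e0.
have /cvgr0Pnorm_le/(_ e e0) := @cvg_exprV_exp b C b1.
apply: filterS => n; apply: le_trans.
rewrite !normrM ler_wpM2r//.
exact: le_trans (yC n) (ler_norm _).
Qed.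

Lemma bval_cst b x : 1 < b -> bval b (cst x) = x / (b - 1).
Proof.
move=> b1; apply: cvg_lim => //.
apply: (@orbit_cvg _ `|x / (b - 1)| _ (fun=> x / (b - 1))) => // k.
by rewrite /cst; field; rewrite subr_eq0 gt_eqF.
Qed.

Section Bounded.
Variables (b C : R) (b1 : 1 < b).

Let b0 : 0 < b. Proof. exact: lt_trans b1. Qed.

Lemma bterm_ge0 d : (forall k, 0 <= d k) -> forall k, 0 <= bterm b d k.
Proof. by move=> d0 k; rewrite mulr_ge0// invr_ge0 exprn_ge0// ltW. Qed.

Lemma bval_is_cvg d : (forall k, 0 <= d k <= C) -> cvgn (series (bterm b d)).
Proof.
move=> dC; apply: (@series_le_cvg _ _ (bterm b (cst C))).
- by apply: bterm_ge0 => k; case/andP: (dC k).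
- by apply: bterm_ge0 => k; case/andP: (dC 0%N) => ? ?; rewrite /cst; lra.
- move=> k; rewrite ler_wpM2r ?invr_ge0 ?exprn_ge0 ?(ltW b0)//.
 by case/andP: (dC k).
- apply/cvg_ex; exists (C / (b - 1)).
  apply: (@orbit_cvg _ `|C / (b - 1)| _ (fun=> C / (b - 1))) => // k.
  by rewrite /cst; field; rewrite subr_eq0 gt_eqF.
Qed.

Lemma series_le_bval d N : (forall k, 0 <= d k <= C) ->
  series (bterm b d) N <= bval b d.
Proof.
move=> dC; apply: nondecreasing_cvgn_le; last exact: bval_is_cvg.
apply: nondecreasing_series => k _ _; apply: bterm_ge0 => // {}k.
by case/andP: (dC k).
Qed.

Lemma bval_ge0 d : (forall k, 0 <= d k <= C) -> 0 <= bval b d.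
Proof.
by move=> dC; have := series_le_bval 0 dC; rewrite /series/= big_geq.
Qed.

Lemma bval_le d : (forall k, 0 <= d k <= C) -> bval b d <= C / (b - 1).
Proof.
move=> dC; rewrite -(bval_cst C b1); apply: lim_series_le.
- exact: bval_is_cvg.
- apply: bval_is_cvg => k; rewrite /cst lexx andbT.
  by case/andP: (dC 0%N) => ? ?; lra.
- move=> k; rewrite ler_wpM2r ?invr_ge0 ?exprn_ge0 ?(ltW b0)//.
  by case/andP: (dC k).
Qed.

Lemma bval_rec d : (forall k, 0 <= d k <= C) ->
  bval b d = (d 0%N + bval b (shift 1 d)) / b.
Proof.
move=> dC; apply: cvg_lim => //; rewrite -(cvg_shiftS (series _)).
have -> : [sequence series (bterm b d) n.+1]_n =
    (fun n => (d 0%N + series (bterm b (shift 1 d)) n) / b).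
  apply/funext => n /=; rewrite /series/= big_nat_recl// mulrDl mulr_suml.
  congr (_ + _).
  apply: eq_bigr => k _; rewrite /bterm /shift add1n [b ^+ k.+2]exprSr invfM.
  by rewrite mulrA.
apply: cvgMl; apply: cvgD; first exact: cvg_cst.
by apply: bval_is_cvg => k; apply: dC.
Qed.

Lemma bval_shiftS d n : (forall k, 0 <= d k <= C) ->
  bval b (shift n.+1 d) = b * bval b (shift n d) - d n.
Proof.
move=> dC; rewrite [in RHS](@bval_rec (shift n d)); last by move=> k; apply: dC.
rewrite shift_shift addn1 /shift addn0; field.
by rewrite gt_eqF.
Qed.

Lemma bval_split d N : (forall k, 0 <= d k <= C) ->
  bval b d = series (bterm b d) N + bval b (shift N d) * b ^- N.
Proof.
move=> dC; rewrite (@bterm_orbit b d (fun n => bval b (shift n d)))//.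
  by rewrite shift0 subrK.
by move=> k; apply: bval_shiftS.
Qed.

Lemma bval_le_series d N : (forall k, 0 <= d k <= C) ->
  bval b d <= series (bterm b d) N + C / (b - 1) * b ^- N.
Proof.
move=> dC; rewrite (bval_split N dC) lerD2l ler_wpM2r ?invr_ge0 ?exprn_ge0 ?(ltW b0)//.
by apply: bval_le => k; apply: dC.
Qed.

Lemma bval_ocons x d : 0 <= x <= C -> (forall k, 0 <= d k <= C) ->
  bval b (ocons x d) = (x + bval b d) / b.
Proof. by move=> xC dC; rewrite bval_rec ?shift1_ocons// => -[|k]/=. Qed.

Lemma bval_gt0 d j : (forall k, 0 <= d k <= C) -> 0 < d j -> 0 < bval b d.
Proof.
move=> dC dj; apply: lt_le_trans (series_le_bval j.+1 dC); rewrite seriesSr.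
apply: ltr_wpDl; last by rewrite mulr_gt0// invr_gt0 exprn_gt0.
by rewrite /series/= sumr_ge0// => k _; apply: bterm_ge0 => // {}k; case/andP: (dC k).
Qed.

End Bounded.

(* Summation by parts: the values of two digit sequences are compared through
   their partial digit sums. *)
Lemma series_bterm_abel b d e j N : 1 <= b -> (j < N)%N ->
  (forall k, (k <= N)%N -> series d k <= series e k) ->
  (series e N - series d N) * b ^- N +
    (series e j - series d j) * (b ^- j - b ^- j.+1) <=
  series (bterm b e) N - series (bterm b d) N.
Proof.
move=> b1; have b0 : 0 < b by lra.
have bX k : b ^- k.+1 = b ^- k / b by rewrite exprS invfM mulrC.
have bV : b^-1 <= 1 by rewrite invf_le1.
have bP k : 0 < b ^- k by rewrite invr_gt0 exprn_gt0.
(* The bound without the extra term at [j]; it starts the induction at [N = j.+1]. *)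
have weak n : (forall k, (k <= n)%N -> series d k <= series e k) ->
    (series e n - series d n) * b ^- n <=
    series (bterm b e) n - series (bterm b d) n.
  elim: n => [|n IH] H; first by rewrite /series/= !big_geq// subrr mul0r.
  have {}IH := IH (fun k kn => H k (leqW kn)).
  rewrite !seriesSr /bterm bX.
  move: IH; set p := b ^- n; set q := b^-1.
  set D := series e n; set D' := series d n.
  have : (D - D') * p * q <= (D - D') * p.
    by rewrite ler_piMr// mulr_ge0 ?subr_ge0 ?H// ltW ?bP.
  by lra.
elim: N => // N IH; rewrite ltnS leq_eqVlt => /predU1P[->|jN] H.
  have := weak N (fun k kN => H k (leqW kN)).
  rewrite !seriesSr /bterm bX; set p := b ^- N; set q := b^-1.
  set D := series e N; set D' := series d N; lra.
have {}IH := IH jN (fun k kN => H k (leqW kN)).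
rewrite !seriesSr /bterm !bX; rewrite bX in IH.
move: IH; set p := b ^- N; set q := b^-1; set D := series e N; set D' := series d N.
have : (D - D') * p * q <= (D - D') * p.
  by rewrite ler_piMr// mulr_ge0 ?subr_ge0 ?H// ltW ?bP.
lra.
Qed.

Section UnitDigits.
Variables (b : R) (b1 : 1 < b) (d e : nat -> R).
Hypotheses (d01 : forall k, 0 <= d k <= 1) (e01 : forall k, 0 <= e k <= 1).

(** Summation by parts compares the first [N] terms; the later digits of [d], being at most 1, add
    at most [(b - 1)^-1 * b ^- N]. *)
Lemma bval_le_near N : (forall k, (k <= N)%N -> series d k <= series e k) ->
  bval b d <= bval b e + (b - 1)^-1 * b ^- N.
Proof.
move=> H; have := bval_le_series b1 N d01; rewrite div1r.
have := series_le_bval b1 N e01.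
suff : series (bterm b d) N <= series (bterm b e) N by lra.
case: N H => [|N] H; first by rewrite /series/= !big_geq.
have := series_bterm_abel (ltW b1) (ltnSn N) H.
suff : 0 <= (series e N.+1 - series d N.+1) * b ^- N.+1 +
    (series e N - series d N) * (b ^- N - b ^- N.+1) by lra.
have b0 : 0 < b := lt_trans ltr01 b1.
rewrite addr_ge0// mulr_ge0 ?subr_ge0 ?H// ?invr_ge0 ?exprn_ge0 ?(ltW b0)//.
by rewrite lef_pV2 ?posrE ?exprn_gt0// ler_weXn2l// ltW.
Qed.

Lemma bval_near N : (forall k, (k <= N)%N -> series d k = series e k) ->
  bval b d <= bval b e + (b - 1)^-1 * b ^- N.
Proof. by move=> H; apply: bval_le_near => k /H ->. Qed.

Lemma bval_lt_partial j : (forall k, series d k <= series e k) ->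
  series d j < series e j -> bval b d < bval b e.
Proof.
move=> H Hj; have b0 : 0 < b := lt_trans ltr01 b1.
(* A single strict partial sum contributes an amount independent of [N], so strictness survives the
   limit. *)
have gap : 0 < (series e j - series d j) * (b ^- j - b ^- j.+1).
  rewrite mulr_gt0 ?subr_gt0// ltf_pV2 ?posrE ?exprn_gt0//.
  by rewrite ltr_eXn2l.
apply: lt_le_trans (_ : bval b d + (series e j - series d j) * (b ^- j - b ^- j.+1) <= _).
  by rewrite ltrDl.
rewrite -lerBrDr; apply: limr_le; first exact: bval_is_cvg d01.
near=> N; have jN : (j < N)%N by near: N; exists j.+1.
have := series_bterm_abel (ltW b1) jN (fun k _ => H k).
have := series_le_bval b1 N e01.
suff : 0 <= (series e N - series d N) * b ^- N by lra.
by rewrite mulr_ge0 ?subr_ge0// invr_ge0 exprn_ge0// ltW.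
Unshelve. all: by end_near. Qed.

Lemma bval_le_partial : (forall k, series d k <= series e k) ->
  bval b d <= bval b e.
Proof.
move=> H; apply: limr_le; first exact: bval_is_cvg d01.
near=> N; apply: le_trans (series_le_bval b1 N e01).
have N0 : (0 < N)%N by near: N; exists 1%N.
have := series_bterm_abel (ltW b1) N0 (fun k _ => H k).
have -> : series e 0 - series d 0 = 0 by rewrite /series/= !big_geq// subrr.
suff : 0 <= (series e N - series d N) * b ^- N by lra.
by rewrite mulr_ge0 ?subr_ge0// invr_ge0 exprn_ge0// ltW// (lt_trans ltr01 b1).
Unshelve. all: by end_near. Qed.

End UnitDigits.

(** After multiplication by the base the terms are [d k * b ^- k], still antitone in [b]. The extra
    factor later turns a weak inequality at one base into a strict one at a larger base. *)
Lemma bvalM_antitone b b' C d : 1 < b -> b <= b' ->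
  (forall k, 0 <= d k <= C) -> b' * bval b' d <= b * bval b d.
Proof.
move=> b1 bb' dC; have b0 : 0 < b by lra. have b'0 : 0 < b' by lra.
rewrite mulrC -ler_pdivlMr//; apply: limr_le.
  by apply: bval_is_cvg dC; lra.
near=> N; rewrite ler_pdivlMr//.
apply: le_trans (_ : b * series (bterm b d) N <= _); last first.
  by rewrite ler_pM2l//; apply: series_le_bval dC.
rewrite /series/= mulr_suml mulr_sumr; apply: ler_sum => k _.
rewrite /bterm !exprS !invfM.
have -> : d k * (b'^-1 / b' ^+ k) * b' = d k * b' ^- k.
  by field; rewrite ?expf_neq0 ?gt_eqF.
have -> : b * (d k * (b^-1 / b ^+ k)) = d k * b ^- k.
  by field; rewrite ?expf_neq0 ?gt_eqF.
apply: ler_wpM2l; first by case/andP: (dC k).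
by rewrite lef_pV2 ?posrE ?exprn_gt0// lerXn2r ?nnegrE ?(ltW b0) ?(ltW b'0).
Unshelve. all: by end_near. Qed.

Lemma bval_antitone b b' C d : 1 < b -> b <= b' ->
  (forall k, 0 <= d k <= C) -> bval b' d <= bval b d.
Proof.
move=> b1 bb' dC; have := bvalM_antitone b1 bb' dC.
have := bval_ge0 b1 dC; have : 0 <= bval b' d by apply: bval_ge0 dC; lra.
by nra.
Qed.

Lemma bval_compl b d : 1 < b -> (forall k, 0 <= d k <= 1) ->
  bval b (fun k => 1 - d k) = (b - 1)^-1 - bval b d.
Proof.
move=> b1 d01; apply: cvg_lim => //.
have -> : series (bterm b (fun k => 1 - d k)) =
    (fun n => series (bterm b (cst 1)) n - series (bterm b d) n).
  apply/funext => n; rewrite /series/= -sumrB; apply: eq_bigr => k _.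
  by rewrite /bterm mulrBl.
apply: cvgB; last exact: bval_is_cvg d01.
rewrite -div1r -bval_cst//; apply: (@bval_is_cvg b 1) => // k.
by rewrite /cst; lra.
Qed.

(** The value of the complementary digits [1 - d k] is antitone too, so no sequence loses more than
    the constant 1. *)
Lemma bval_lipschitz b b' d : 1 < b -> b <= b' ->
  (forall k, 0 <= d k <= 1) ->
  bval b d - bval b' d <= (b - 1)^-1 - (b' - 1)^-1.
Proof.
move=> b1 bb' d01; have b'1 : 1 < b' by lra.
suff : bval b' (fun k => 1 - d k) <= bval b (fun k => 1 - d k).
  by rewrite !bval_compl//; lra.
by apply: (@bval_antitone _ _ 1) => // k; have := d01 k; lra.
Qed.

End Values.

(** * Unique expansions over three digits *)

Section Univoque.
Context {R : realType}.
Implicit Types (A : set R) (b m x y : R) (u v w : nat -> R).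

Definition ternary m : set R := [set (0 : R); 1; m].

Lemma ternaryP m x : ternary m x <-> [\/ x = 0, x = 1 | x = m].
Proof.
split; first by move=> [[]|]; [constructor 1|constructor 2|constructor 3].
by case=> ->; [left; left|left; right|right].
Qed.

Lemma ternary_itv m x : 1 < m -> ternary m x -> 0 <= x <= m.
Proof. by move=> m1 /ternaryP[] ->; lra. Qed.

Lemma expansionP m b x u : 1 < m -> 1 < b ->
  expansion (ternary m) b x u <-> (forall k, ternary m (u k)) /\ bval b u = x.
Proof.
move=> m1 b1; split=> -[uA ux]; split => //; first exact: cvg_lim ux.
rewrite -ux; apply: (@bval_is_cvg _ _ m b1) => k.
exact: ternary_itv (uA k).
Qed.

Lemma univoqueP m b u : 1 < m -> 1 < b ->
  univoque b (ternary m) u <-> (forall k, ternary m (u k)) /\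
    forall v, (forall k, ternary m (v k)) -> bval b v = bval b u -> v = u.
Proof.
move=> m1 b1; split=> [[x /expansionP[]// uA <- h]|[uA h]].
  by split=> // v vA vu; apply: h; apply/expansionP.
exists (bval b u); first exact/expansionP.
by move=> v /expansionP[]// vA /h; apply.
Qed.

(** Greedy algorithm: as [b <= 1 + m], the digit gaps 1 and [m - 1] are at most [m / (b - 1)], so
    the remainder never leaves the interval. *)
Lemma expansion_exists m b y : 1 < m <= 2 -> 1 < b <= 1 + m ->
  0 <= y <= m / (b - 1) ->
  exists2 w, (forall k, ternary m (w k)) & bval b w = y.
Proof.
move=> m12 b12 y0.
pose dig (z : R) : R := if b * z < 1 then 0 else if b * z < m then 1 else m.
pose Y n := iter n (fun z => b * z - dig z) y.
have KE : m / (b - 1) * b = m + m / (b - 1) by field; lra.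
have K1 : 1 <= m / (b - 1) by rewrite ler_pdivlMr; lra.
have Y0 n : 0 <= Y n <= m / (b - 1).
  elim: n => //= n; rewrite -/(Y n) /dig; move: (Y n) KE K1 => z.
  move: (m / (b - 1)) => K KE K1 /andP[z0 zK].
  have : b * z <= K * b by rewrite mulrC ler_pM2r; lra.
  have : 0 <= b * z by rewrite mulr_ge0; lra.
  by case: ifP => ?; [|case: ifP => ?]; lra.
exists (fun n => dig (Y n)).
  move=> n; rewrite /dig; apply/ternaryP.
  by case: ifP => _; [constructor 1|case: ifP => _; [constructor 2|constructor 3]].
apply: cvg_lim => //; apply: (@orbit_cvg _ b (m / (b - 1)) _ Y) => // [|n].
  by case/andP: b12.
by rewrite ger0_norm; case/andP: (Y0 n).
Qed.

Lemma univoque_shift m b u n : 1 < m -> 1 < b ->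
  univoque b (ternary m) u -> univoque b (ternary m) (shift n u).
Proof.
move=> m1 b1; elim: n => [|n]; first by rewrite shift0.
move=> IH /IH {IH}; rewrite -addn1 -shift_shift; move: (shift n u) => {}u.
move=> /univoqueP[]// uA h; apply/univoqueP => //; split=> [k|v vA vu].
  exact: uA.
have vC k := ternary_itv m1 (vA k).
have uC k := ternary_itv m1 (uA k).
rewrite -[v](shift1_ocons (u 0%N)) (h (ocons (u 0%N) v))// => [[|k]//|].
- exact: uA.
- exact: vA.
by rewrite (bval_ocons b1 (uC _) vC) (bval_rec b1 uC) vu.
Qed.

(** Otherwise the remainder left after the digit [a] could be expanded, giving a second expansion of
    the same tail. *)
Lemma univoque_digit m b u n a : 1 < m <= 2 -> 1 < b <= 1 + m ->
  univoque b (ternary m) u -> ternary m a -> a <> u n ->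
  ~ (0 <= u n + bval b (shift n.+1 u) - a <= m / (b - 1)).
Proof.
move=> m12 b12; have m1 : 1 < m by lra.
have b1 : 1 < b by lra.
move=> /(univoque_shift n m1 b1); rewrite -addn1 -shift_shift.
have -> : u n = shift n u 0%N by rewrite /shift addn0.
move: (shift n u) => {}u /univoqueP[]// uA h aA au.
move=> /(expansion_exists m12 b12)[w wA wE]; apply: au.
have wC k := ternary_itv m1 (wA k).
have uC k := ternary_itv m1 (uA k).
rewrite -(h (ocons a w))// => [[|k]//|].
  exact: wA.
rewrite (bval_ocons b1 (ternary_itv m1 aA) wC) (bval_rec b1 uC) wE.
by congr (_ / _); rewrite addrC subrK.
Qed.

(** Tails of a competing sequence have values in [[0, m / (b - 1)]]; hence, by induction, it can
    never choose another digit than [u]. *)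
Lemma univoque_of_digits m b u : 1 < m -> 1 < b ->
  (forall k, ternary m (u k)) ->
  (forall n a, ternary m a -> a <> u n ->
    ~ (0 <= u n + bval b (shift n.+1 u) - a <= m / (b - 1))) ->
  univoque b (ternary m) u.
Proof.
move=> m1 b1 uA h; apply/univoqueP => //; split=> // v vA vu.
have vC k := ternary_itv m1 (vA k).
have uC k := ternary_itv m1 (uA k).
have step n : bval b (shift n v) = bval b (shift n u) -> v n = u n.
  move=> E; apply: contrapT => /(h n _ (vA n)); apply.
  have vE := bval_shiftS b1 n vC; have uE := bval_shiftS b1 n uC.
  have -> : u n + bval b (shift n.+1 u) - v n = bval b (shift n.+1 v).
    by rewrite uE vE E; ring.
  have sC k : 0 <= shift n.+1 v k <= m by apply: vC.
  by rewrite (bval_ge0 b1 sC) (bval_le b1 sC).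
have E n : bval b (shift n v) = bval b (shift n u).
  elim: n => [|n IH]; first by rewrite !shift0.
  by rewrite (bval_shiftS b1 n vC) (bval_shiftS b1 n uC) IH (step n IH).
by apply/funext => n; apply: step.
Qed.

Lemma univoque_cst0 m b : 1 < m -> 1 < b -> univoque b (ternary m) (cst 0).
Proof.
move=> m1 b1; apply: univoque_of_digits => // [k|n a aA a0].
  by apply/ternaryP; constructor 1.
have -> : shift n.+1 (cst (0 : R)) = cst 0 by [].
rewrite bval_cst// mul0r.
move: aA a0 => /ternaryP[] -> // _; rewrite /cst; lra.
Qed.

Lemma univoque_cstm m b : 1 < m -> 1 < b -> univoque b (ternary m) (cst m).
Proof.
move=> m1 b1; apply: univoque_of_digits => // [k|n a aA a0].
  by apply/ternaryP; constructor 3.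
have -> : shift n.+1 (cst m) = cst m by [].
rewrite bval_cst//; move: (m / (b - 1)) => K.
move: aA a0 => /ternaryP[] -> // _; rewrite /cst; lra.
Qed.

Lemma trivial_sequences_ternary m : 1 < m ->
  trivial_sequences (ternary m) = [set cst 0; cst m].
Proof.
move=> m1; rewrite /trivial_sequences.
have lb : lbound (ternary m) 0 by move=> x /(ternary_itv m1)/andP[].
have ub : ubound (ternary m) m by move=> x /(ternary_itv m1)/andP[].
have A0 : ternary m 0 by apply/ternaryP; constructor 1.
have Am : ternary m m by apply/ternaryP; constructor 3.
have -> : inf (ternary m) = 0.
  apply/eqP; rewrite eq_le; apply/andP; split.
    by apply: ge_inf => //; exists 0.
  by apply: lb_le_inf => //; exists 0.
have -> // : sup (ternary m) = m.
apply/eqP; rewrite eq_le; apply/andP; split.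
  by apply: ge_sup => //; exists 0.
by apply: ub_le_sup => //; exists m.
Qed.

(* Below base 1 + sqrt m the words 0m, 1m and m0 are forbidden, so that after
   its first digit 1 a nontrivial univoque sequence is binary. *)
Lemma univoque_binary_tail m b u : 1 < m <= 2 -> 1 < b -> (b - 1) ^+ 2 < m ->
  univoque b (ternary m) u -> u <> cst 0 -> u <> cst m ->
  exists v, [/\ 2 < b, forall k, v k = 0 \/ v k = 1,
    forall n, m / (b - 1) - 1 < bval b (shift n v),
    forall n, v n = 1 -> bval b (shift n.+1 v) < m - 1 &
    forall n, v n = 0 -> m - 1 < bval b (shift n.+1 v)].
Proof.
move=> m12 b1 bm uu u0 um; have m1 : 1 < m by lra.
have b12 : 1 < b <= 1 + m by rewrite expr2 in bm; apply/andP; split; nra.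
have [uA _] := (univoqueP u m1 b1).1 uu.
have uC k := ternary_itv m1 (uA k).
pose y n := bval b (shift n u).
have yS n : y n.+1 = b * y n - u n by exact: (bval_shiftS b1 n uC).
have D n a := @univoque_digit m b u n a m12 b12 uu.
have A0 : ternary m 0 by apply/ternaryP; constructor 1.
have A1 : ternary m 1 by apply/ternaryP; constructor 2.
have Am : ternary m m by apply/ternaryP; constructor 3.
have y0 n : 0 <= y n by apply: (bval_ge0 b1 (C := m)) => k; apply: uC.
have yK n : y n <= m / (b - 1) by apply: (bval_le b1) => k; apply: uC.
have KE : m / (b - 1) * (b - 1) = m by field; lra.
move: D yK KE; set K := m / (b - 1) => D yK KE.
have Kb : b - 1 < K by rewrite expr2 in bm; nra.
(* Each other digit must push the remainder out of [[0, K]], which bounds the value of the next tail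
   from one side. *)
have D0 n : u n = 0 -> y n.+1 < 1.
  move=> un; have := D n 1 A1; rewrite un -/(y n.+1) => /(_ ltac:(lra)).
  move=> h; rewrite ltNge; apply/negP => h'; apply: h.
  by have := yK n.+1; lra.
have D1 n : u n = 1 -> K - 1 < y n.+1 < m - 1.
  move=> un; have := D n 0 A0; have := D n m Am; rewrite un -/(y n.+1).
  move=> /(_ ltac:(lra)) h /(_ ltac:(lra)) h'.
  have := yK n.+1; have := y0 n.+1 => ? ?.
  rewrite !ltNge; apply/andP; split; apply/negP => h2; [apply: h'|apply: h]; lra.
have Dm n : u n = m -> K - (m - 1) < y n.+1.
  move=> un; have := D n 1 A1; rewrite un -/(y n.+1) => /(_ ltac:(lra)).
  move=> h; rewrite ltNge; apply/negP => h'; apply: h.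
  by have := y0 n.+1; lra.
(* A digit [m] after 0 or 1 would give [b > b * y n.+1 = m + y n.+2 > K + 1], against
   [K > b - 1]. *)
have forb_m n : u n < m -> u n.+1 < m.
  have := ternaryP m (u n.+1); case=> /(_ (uA n.+1))[] un1 _; try lra.
  have := Dm _ un1; have := yS n.+1; rewrite un1 => h1 h2 un.
  have : y n.+1 < 1.
    have /ternaryP[e|e|e] := uA n; [exact: D0|have := D1 _ e; lra|lra].
  nra.
(* The word m0 would need [b * (K - m + 1) < 1], but [b * (K - m + 1) - 1 = K - (b - 1) * (m - 1) >
   0]. *)
have forb_m0 n : u n = m -> u n.+1 <> 0.
  move=> un un1; have := Dm _ un; have := yS n.+1; have := D0 _ un1.
  by rewrite un1 => *; nra.
(* Without a digit 1, the forbidden words 0m and m0 leave only the two constant sequences. *)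
have [N uN] : exists N, u N = 1.
  apply: contrapT => no1; have {}no1 n : u n <> 1.
    by move=> h; apply: no1; exists n.
  have /ternaryP[e|e|e] := uA 0%N; first 2 last.
  - apply: um; apply/funext; elim=> // n IH.
    have /ternaryP[e'|e'|//] := uA n.+1; last by have := no1 n.+1.
    by have := forb_m0 n IH.
  - apply: u0; apply/funext; elim=> // n IH.
    have /ternaryP[//|e'|e'] := uA n.+1; first by have := no1 n.+1.
    by have := forb_m n; rewrite IH e' /cst; lra.
  - by have := no1 0%N.
(* The two bounds of [D1] give [K < m], that is [b - 1 > 1]. *)
have b2 : 2 < b by have := D1 _ uN; nra.
have bin k : u (N + k)%N < m.
  by elim: k => [|k IH]; [rewrite addn0 uN|rewrite addnS; apply: forb_m].
(* A digit 1 renews this bound, and a digit 0 multiplies the value by [b]. *)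
have yN n : K - 1 < y (N.+1 + n)%N.
  elim: n => [|n IH]; first by rewrite addn0; have := D1 _ uN; lra.
  rewrite addnS.
  have /ternaryP[e|e|e] := uA (N.+1 + n)%N.
  - by rewrite yS e; nra.
  - by have := D1 _ e; lra.
  - by move: (bin n.+1); rewrite addnS -addSn; lra.
exists (shift N.+1 u); split => // [k|n|n|n]; rewrite ?shift_shift ?addnS.
- rewrite /shift; have /ternaryP[|| e] := uA (N.+1 + k)%N; [by left|by right|].
  by move: (bin k.+1); rewrite addnS -addSn; lra.
- exact: yN.
- by move=> /D1; rewrite -/(y _); lra.
(* Here [b * (K - 1) = K + m - b > m - 1]. *)
- by rewrite -/(y _) yS /shift => ->; have := yN n; nra.
Qed.

End Univoque.

(** * Mechanical words: order and limits with respect to the slope *)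

Section MechanicalWords.
Context {R : realType}.
Implicit Types (b t x y : R) (d e : nat -> R) (n k N : nat).

Local Notation flr x := ((Num.floor x)%:~R : R).
Local Notation cei x := ((Num.ceil x)%:~R : R).

Lemma int_num_lt x y : x \is a Num.int -> y \is a Num.int ->
  (x < y) = (x + 1 <= y).
Proof.
move=> /intrP[i ->] /intrP[j ->].
by rewrite -[1]/(1%:~R) -intrD ltr_int ler_int; apply/idP/idP; lia.
Qed.

Lemma flrP x : flr x <= x /\ x < flr x + 1.
Proof. by have /andP[] := floor_itv x; rewrite intrD. Qed.

Lemma ceiP x : x <= cei x /\ cei x < x + 1.
Proof. by have /andP[] := ceil_itv x; rewrite intrB ltrBlDr. Qed.

Definition lower_word t k : R := flr (k.+1%:R * t) - flr (k%:R * t).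

(* The upper mechanical word of slope t without its first letter. *)
Definition upper_word t k : R := cei (k.+2%:R * t) - cei (k.+1%:R * t).

Lemma series_lower t k : series (lower_word t) k = flr (k%:R * t).
Proof.
rewrite /series/= (telescope_sumr (fun k => flr (k%:R * t)))//.
by rewrite mul0r floor0 subr0.
Qed.

Lemma series_upper t k : 0 < t <= 1 ->
  series (upper_word t) k = cei (k.+1%:R * t) - 1.
Proof.
move=> t01; rewrite /series/= (telescope_sumr (fun k => cei (k.+1%:R * t)))//.
rewrite mul1r (_ : Num.ceil t = 1)//; apply/eqP; rewrite ceil_eq.
by rewrite subrr.
Qed.

Lemma series_shift d n k : series (shift n d) k = series d (n + k)%N - series d n.
Proof.
elim: k => [|k IH]; first by rewrite addn0 subrr /series/= big_geq.
by rewrite addnS !seriesSr IH /shift addrAC.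
Qed.

Lemma series_shift_lower t k : 0 <= t < 1 ->
  series (shift 1 (lower_word t)) k = flr (k.+1%:R * t).
Proof.
move=> t01; rewrite series_shift add1n !series_lower mul1r.
by rewrite (_ : Num.floor t = 0) ?subr0//; apply/eqP; rewrite floor_eq.
Qed.

Lemma lower_binary t k : 0 <= t <= 1 -> lower_word t k = 0 \/ lower_word t k = 1.
Proof.
move=> t01; rewrite /lower_word -[k.+1]addn1 natrD mulrDl mul1r.
set x := k%:R * t; have [h1 h2] := flrP x; have [h3 h4] := flrP (x + t).
have [h|h] := ltP (flr x) (flr (x + t)); last first.
  by left; have := @int_num_lt (flr (x + t)) (flr x); rewrite !intr_int => /(_ isT isT); lra.
right; move: h; rewrite int_num_lt ?intr_int// => h.
have := @int_num_lt (flr x + 1) (flr (x + t)).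
by rewrite rpredD ?intr_int ?rpred1// => /(_ isT isT); lra.
Qed.

Lemma lower_unit t k : 0 <= t <= 1 -> 0 <= lower_word t k <= 1.
Proof. by move=> t01; case: (lower_binary k t01) => ->; lra. Qed.

Lemma upper_unit t k : 0 <= t <= 1 -> 0 <= upper_word t k <= 1.
Proof.
move=> t01; rewrite /upper_word -[k.+2]addn1 natrD mulrDl mul1r.
set x := k.+1%:R * t; have [h1 h2] := ceiP x; have [h3 h4] := ceiP (x + t).
have := @int_num_lt (cei (x + t)) (cei x).
have := @int_num_lt (cei x + 1) (cei (x + t)).
by rewrite rpredD ?intr_int ?rpred1// => /(_ isT isT) ? /(_ isT isT) ?; lra.
Qed.

Lemma lower_word0 : lower_word 0 = cst 0.
Proof. by apply/funext => k; rewrite /lower_word !mulr0 floor0 subrr. Qed.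

Lemma lower_word1 : lower_word 1 = cst 1.
Proof.
apply/funext => k; rewrite /lower_word !mulr1 !pmulrn !intrKfloor.
by rewrite -!pmulrn -natr1 addrC addKr.
Qed.

Section Comparison.
Variables (b : R) (b1 : 1 < b).

(** At [x = k.+1%:R * t] the partial sums are [cei x - 1] and [flr x], and [cei x - 1 <= flr x] for
    every real [x]. *)
Lemma bval_upper_le_lower t : 0 < t < 1 ->
  bval b (upper_word t) <= bval b (shift 1 (lower_word t)).
Proof.
move=> t01; apply: bval_le_partial => // k.
- by apply: upper_unit; lra.
- by apply: lower_unit; lra.
- rewrite series_upper ?series_shift_lower; try lra.
  have [h1 h2] := ceiP (k.+1%:R * t); have [h3 h4] := flrP (k.+1%:R * t).
  have := @int_num_lt (flr (k.+1%:R * t)) (cei (k.+1%:R * t) - 1).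
  by rewrite rpredB ?intr_int ?rpred1// => /(_ isT isT); lra.
Qed.

(* The two words differ as soon as (k + 1) t is an integer. *)
Lemma bval_upper_lt_lower t k : 0 < t < 1 -> k.+1%:R * t \is a Num.int ->
  bval b (upper_word t) < bval b (shift 1 (lower_word t)).
Proof.
move=> t01 kt; apply: (@bval_lt_partial _ _ _ _ _ _ _ k) => // [j|j|j|].
- by apply: upper_unit; lra.
- by apply: lower_unit; lra.
- rewrite series_upper ?series_shift_lower; try lra.
  have [h1 h2] := ceiP (j.+1%:R * t); have [h3 h4] := flrP (j.+1%:R * t).
  have := @int_num_lt (flr (j.+1%:R * t)) (cei (j.+1%:R * t) - 1).
  by rewrite rpredB ?intr_int ?rpred1// => /(_ isT isT); lra.
- rewrite series_upper ?series_shift_lower; try lra.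
  move: kt; rewrite intrEfloor => /eqP E.
  by rewrite -[in Num.ceil _]E intrKceil; lra.
Qed.

Lemma bval_lower_lt_upper t t' : 0 <= t < t' -> t' <= 1 ->
  bval b (shift 1 (lower_word t)) < bval b (upper_word t').
Proof.
move=> tt' t'1; have le k : flr (k.+1%:R * t) <= cei (k.+1%:R * t') - 1.
  have [h1 h2] := ceiP (k.+1%:R * t'); have [h3 h4] := flrP (k.+1%:R * t).
  have := @int_num_lt (cei (k.+1%:R * t') - 1) (flr (k.+1%:R * t)).
  rewrite rpredB ?intr_int ?rpred1// => /(_ isT isT).
  have : k.+1%:R * t < k.+1%:R * t' by rewrite ltr_pM2l; case/andP: tt'.
  by lra.
(* At this index [k.+1%:R * (t' - t) > 2], which outweighs the rounding and makes one partial sum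
   strictly larger. *)
pose k := Num.truncn (2 / (t' - t)).
apply: (@bval_lt_partial _ _ _ _ _ _ _ k) => // [j|j|j|].
- by apply: lower_unit; lra.
- by apply: upper_unit; lra.
- by rewrite series_upper ?series_shift_lower//; lra.
- rewrite series_upper ?series_shift_lower; try lra.
  have [h1 h2] := ceiP (k.+1%:R * t'); have [h3 h4] := flrP (k.+1%:R * t).
  have : 2 / (t' - t) < k.+1%:R by apply: truncnS_gt.
  by rewrite ltr_pdivrMr; lra.
Qed.

Lemma bval_upper_lt t t' : 0 < t < t' -> t' <= 1 ->
  bval b (upper_word t) < bval b (upper_word t').
Proof.
move=> tt' t'1; apply: le_lt_trans (bval_upper_le_lower _) _; first lra.
by apply: bval_lower_lt_upper => //; lra.
Qed.

Lemma bval_lower t : 0 <= t < 1 ->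
  bval b (lower_word t) = bval b (shift 1 (lower_word t)) / b.
Proof.
move=> t01; rewrite (@bval_rec _ b 1)// => [|k]; last by apply: lower_unit; lra.
rewrite {1}/lower_word mul1r mul0r floor0 (_ : Num.floor t = 0) ?subr0 ?add0r//.
by apply/eqP; rewrite floor_eq.
Qed.

Lemma bval_upper_ge0 t : 0 < t <= 1 -> 0 <= bval b (upper_word t).
Proof.
by move=> t01; apply: (@bval_ge0 _ _ 1) => // k; apply: upper_unit; lra.
Qed.

Lemma exists_small_expr y : 0 < y -> exists N, (b - 1)^-1 * b ^- N < y.
Proof.
move=> y0; have /cvgr0Pnorm_lt/(_ y y0) := @cvg_exprV_exp _ b (b - 1)^-1 b1.
by move=> [N _ /(_ N (leqnn N)) h]; exists N; apply: le_lt_trans h; exact: ler_norm.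
Qed.

End Comparison.

Lemma finite_gauge (P : nat -> R -> Prop) N :
  (forall k, exists2 x, 0 < x & forall y, 0 < y < x -> P k y) ->
  exists2 x, 0 < x & forall y, 0 < y < x -> forall k, (k <= N)%N -> P k y.
Proof.
move=> H; elim: N => [|N [x x0 IH]].
  have [x x0 h] := H 0%N; exists x => // y yx k.
  by rewrite leqn0 => /eqP ->; apply: h.
have [z z0 h] := H N.+1; exists (Num.min x z); first by rewrite lt_min x0.
move=> y; rewrite lt_min => /and3P[y0 yx yz] k.
by rewrite leq_eqVlt ltnS => /predU1P[->|]; [apply: h|apply: IH]; rewrite ?y0.
Qed.

(** The ceiling is left-continuous, so each prefix of the upper word is constant just to the left of
    [t]. *)
Lemma upper_word_left t N : 0 < t <= 1 ->
  exists2 x, 0 < x & forall t', t - x < t' < t -> 0 < t' /\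
    forall k, (k <= N)%N -> series (upper_word t') k = series (upper_word t) k.
Proof.
move=> t01.
have [|x x0 h] := @finite_gauge (fun k y => y < t ->
   cei (k.+1%:R * (t - y)) = cei (k.+1%:R * t)) N.
  move=> k; have [h1 h2] := ceiP (k.+1%:R * t).
  exists ((k.+1%:R * t - (cei (k.+1%:R * t) - 1)) / k.+1%:R).
    by rewrite divr_gt0//; lra.
  move=> y /andP[y0]; rewrite ltr_pdivlMr// => yk yt; congr (_ %:~R).
  apply/eqP; rewrite ceil_eq intrB mulrBr.
  have : 0 < k.+1%:R * y by rewrite mulr_gt0.
  by move: yk; rewrite [y * _]mulrC; lra.
exists (Num.min x t); first by rewrite lt_min x0; case/andP: t01.
move=> t'; rewrite ltrBlDr -ltrBlDl lt_min => /andP[/andP[h1 h2] h3].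
split=> [|k kN]; first lra.
rewrite !series_upper; try lra.
rewrite -(h (t - t') _ k kN); [|lra|lra].
by rewrite subKr.
Qed.

(** The right limit of the ceiling at [x] is [flr x + 1]: from the right, upper words converge to
    the shifted lower word. *)
Lemma upper_word_right t N : 0 <= t < 1 ->
  exists2 x, 0 < x & forall t', t < t' < t + x -> t' <= 1 /\
    forall k, (k <= N)%N ->
      series (upper_word t') k = series (shift 1 (lower_word t)) k.
Proof.
move=> t01.
have [|x x0 h] := @finite_gauge (fun k y =>
   cei (k.+1%:R * (t + y)) = flr (k.+1%:R * t) + 1) N.
  move=> k; have [h1 h2] := flrP (k.+1%:R * t).
  exists ((flr (k.+1%:R * t) + 1 - k.+1%:R * t) / k.+1%:R).
    by rewrite divr_gt0//; lra.
  move=> y /andP[y0]; rewrite ltr_pdivlMr// => yk.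
  rewrite -[1]/(1%:~R) -intrD; congr (_ %:~R).
  apply/eqP; rewrite ceil_eq intrB intrD mulrDr.
  have : 0 < k.+1%:R * y by rewrite mulr_gt0.
  by move: yk; rewrite [y * _]mulrC; lra.
exists (Num.min x (1 - t)); first by rewrite lt_min x0; lra.
move=> t'; rewrite -ltrBlDl lt_min => /andP[h3 /andP[h1 h2]].
split=> [|k kN]; first lra.
rewrite series_upper ?series_shift_lower; try lra.
rewrite (_ : _ * t' = k.+1%:R * (t + (t' - t))); last by rewrite subrKC.
by rewrite (h (t' - t) _ k kN); lra.
Qed.

(* Every cut y > 0 of the value line lies in, or at an end of, the gap between
   the upper and the shifted lower word of some slope. *)
Lemma exists_slope b y : 1 < b -> 0 < y ->
  exists t, [/\ 0 < t <= 1, bval b (upper_word t) <= y &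
    t = 1 \/ t < 1 /\ y <= bval b (shift 1 (lower_word t))].
Proof.
move=> b1 y0; pose S := [set t | 0 < t <= 1 /\ bval b (upper_word t) <= y].
have U t k : 0 < t <= 1 -> 0 <= upper_word t k <= 1.
  by move=> t01; apply: upper_unit; lra.
have L t k : 0 <= t <= 1 -> 0 <= shift 1 (lower_word t) k <= 1.
  by move=> t01; apply: lower_unit; lra.
(* Upper words of small slope share a long prefix with the zero word. *)
have [s0 Ss0] : S !=set0.
  have [N yN] := exists_small_expr b1 y0.
  have [x x0 h] := @upper_word_right 0 N ltac:(lra).
  have [|x1 {}h] := h (x / 2); first lra.
  exists (x / 2); split; first lra.
  have := bval_near b1 (fun k => U (x / 2) k ltac:(lra)) (fun k => L 0 k ltac:(lra))
     h.
  rewrite lower_word0 (_ : shift 1 (cst 0) = cst (0 : R))//.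
  by rewrite bval_cst// mul0r; lra.
have Sub : ubound S 1 by move=> t [] /andP[].
have supS : has_sup S by split; [exists s0|exists 1].
pose t := sup S.
have t01 : 0 < t <= 1.
  rewrite ge_sup ?andbT//; last by exists s0.
  by apply: lt_le_trans (ub_le_sup _ Ss0); [case: Ss0 => /andP[]|exists 1].
(* By the left limit, the supremum itself belongs to [S]. *)
have St : bval b (upper_word t) <= y.
  apply/ler_addgt0Pr => e e0; have [N eN] := exists_small_expr b1 e0.
  have [x x0 h] := upper_word_left N t01.
  have [s [s01 sy] ts] := sup_adherent x0 supS.
  have : s <= t by apply: ub_le_sup => //; exists 1.
  rewrite le_eqVlt => /predU1P[<-|st]; first lra.
  have [|_ {}h] := h s; first by rewrite -/t in ts; rewrite ts st.
  have := bval_near b1 (fun k => U t k t01) (fun k => U s k s01)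
     (fun k kN => esym (h k kN)).
  lra.
exists t; split => //; have [t1|t1] := ltP t 1; last by left; lra.
(* Slopes just above [t] are not in [S], so their upper words exceed [y], while they approximate the
   shifted lower word of slope [t]. *)
right; split => //; apply/ler_addgt0Pr => e e0.
have [N eN] := exists_small_expr b1 e0.
have [x x0 h] := @upper_word_right t N ltac:(lra).
have [|x1 {}h] := h (t + x / 2); first lra.
have := bval_near b1 (fun k => U (t + x / 2) k ltac:(lra)) (fun k => L t k ltac:(lra))
     h.
suff : y < bval b (upper_word (t + x / 2)) by lra.
rewrite ltNge; apply/negP => h'.
have : t + x / 2 <= t by apply: ub_le_sup => //; [exists 1|split => //; lra].
lra.
Qed.

(** Both sides are compared with [j.+1%:R * (k.+1%:R * t)]. The resulting inequality no longer
    mentions the slope, so it constrains the partial sums alone. *)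
Lemma lower_balanced t j k : 0 <= t < 1 ->
  j.+1%:R * series (shift 1 (lower_word t)) k <
  k.+1%:R * (series (shift 1 (lower_word t)) j + 1).
Proof.
move=> t01; rewrite !series_shift_lower//.
have [h1 _] := flrP (k.+1%:R * t); have [_ h2] := flrP (j.+1%:R * t).
apply: le_lt_trans (_ : j.+1%:R * (k.+1%:R * t) < _); first by rewrite ler_pM2l.
by rewrite mulrCA ltr_pM2l.
Qed.

Lemma upper_balanced t j k : 0 < t <= 1 ->
  j.+1%:R * series (upper_word t) k < k.+1%:R * (series (upper_word t) j + 1).
Proof.
move=> t01; rewrite !series_upper//.
have [_ h1] := ceiP (k.+1%:R * t); have [h2 _] := ceiP (j.+1%:R * t).
apply: lt_le_trans (_ : j.+1%:R * (k.+1%:R * t) <= _); first by rewrite ltr_pM2l//; lra.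
by rewrite mulrCA ler_pM2l//; lra.
Qed.

End MechanicalWords.

(** * The rotation number of a binary sequence whose tails are separated by [c] *)

Section RotationNumber.
Context {R : realType}.
Implicit Types (x t : R) (n k N : nat).

Variables (b kappa c : R) (v : nat -> R).
Hypotheses (b2 : 2 < b) (kappa0 : 0 < kappa).
Hypothesis v01 : forall k, v k = 0 \/ v k = 1.
Hypothesis lb_tail : forall n, kappa < bval b (shift n v).
Hypothesis tail1 : forall n, v n = 1 -> bval b (shift n.+1 v) < c.
Hypothesis tail0 : forall n, v n = 0 -> c < bval b (shift n.+1 v).

Let b1 : 1 < b. Proof. by apply: lt_trans b2; rewrite ltr1n. Qed.

Let H n k : R := series (shift n v) k.

Let v_unit k : 0 <= v k <= 1.
Proof. by case: (v01 k) => ->; rewrite ?lexx ?ler01. Qed.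

Let H_int n k : H n k \is a Num.int.
Proof.
rewrite /H /series/= rpred_sum// => i _; rewrite /shift.
by case: (v01 (n + i)%N) => ->; rewrite ?rpred0 ?rpred1.
Qed.

Let HD n j k : H n (j + k) = H n j + H (n + j) k.
Proof. by rewrite /H !series_shift addnA; lra. Qed.

Let H0 n : H n 0 = 0. Proof. by rewrite /H /series/= big_geq. Qed.

Let HS n k : H n k.+1 = H n k + v (n + k)%N.
Proof. by rewrite /H seriesSr. Qed.

Let H_itv n k : 0 <= H n k <= k%:R.
Proof.
elim: k => [|k IH]; first by rewrite H0 lexx.
by rewrite HS -natr1; have := v_unit (n + k)%N; lra.
Qed.

(* The digit shift preserves the lexicographic order on the pairs
   (number of digits 1 read so far, current tail value). *)
Let H_order n n' k : bval b (shift n v) <= bval b (shift n' v) ->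
  H n k < H n' k \/
  H n k = H n' k /\ bval b (shift (n + k) v) <= bval b (shift (n' + k) v).
Proof.
move=> le; elim: k => [|k IH]; first by right; rewrite !H0 !addn0.
have I := int_num_lt (H_int n k) (H_int n' k).
have uS i := bval_shiftS b1 i v_unit.
rewrite !HS !addnS; case: IH => [|[-> IH]].
  (* A lead of 1 is lost only by reading 1 from [n] against 0 from [n']; then the two new tail
     values lie on opposite sides of [c]. *)
  rewrite I => {}I.
  case: (v01 (n + k)%N) (@tail1 (n + k)%N) => -> t1;
    case: (v01 (n' + k)%N) (@tail0 (n' + k)%N) => -> t0; try (left; lra).
  have := t1 erefl; have := t0 erefl => ? ?.
  move: I; rewrite le_eqVlt => /predU1P[I|I]; last by left; lra.
  by right; split; lra.
have b0 := lt_trans ltr01 b1.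
case: (v01 (n + k)%N) => e; case: (v01 (n' + k)%N) => e'; rewrite !uS e e'.
- by right; split => //; rewrite !subr0 ler_pM2l.
- by left; lra.
(* A tail starting with 1 has a larger value than one starting with 0, because [1 / (b - 1) < 1] for
   [b > 2]. *)
- exfalso; have le1 : b * bval b (shift (n + k) v) <= b * bval b (shift (n' + k) v).
    by rewrite ler_pM2l.
  have := uS (n + k)%N; have := uS (n' + k)%N; rewrite e e' => yn' yn.
  have ge0 := bval_ge0 b1 (fun i => v_unit ((n + k).+1 + i)%N).
  have lt1 := bval_le b1 (fun i => v_unit ((n' + k).+1 + i)%N).
  have : 1 / (b - 1) < 1 by rewrite ltr_pdivrMr; move: b2; lra.
  by move: ge0 lt1; rewrite -/(shift _ _) -/(shift _ _); lra.
- by right; split => //; rewrite lerD2r ler_pM2l.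
Qed.

(** One comparison of tail values thus orders the counts of 1 in windows of every length. *)
Let H_mono n n' k : bval b (shift n v) <= bval b (shift n' v) -> H n k <= H n' k.
Proof. by move=> /(@H_order _ _ k)[/ltW|[-> _]]. Qed.

Let H_windows_ge x j k n : (forall n, x <= H n j) -> k%:R * x <= H n (k * j).
Proof.
move=> xH; elim: k n => [|k IH] n; first by rewrite mul0r mul0n H0.
by rewrite mulSn HD -natr1; have := IH (n + j)%N; have := xH n; lra.
Qed.

Let H_windows_le x j k n : (forall n, H n j <= x) -> H n (k * j) <= k%:R * x.
Proof.
move=> xH; elim: k n => [|k IH] n; first by rewrite mul0r mul0n H0.
by rewrite mulSn HD -natr1; have := IH (n + j)%N; have := xH n; lra.
Qed.

(** Uniform lower bounds for the frequency of 1 in all windows of some length; their supremum [t] is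
    the rotation number. *)
Let slopes := [set x | exists2 k, (0 < k)%N & forall n, k%:R * x <= H n k].
Let t := sup slopes.

Let slopes1 : ubound slopes 1.
Proof.
move=> x [k k0 /(_ 0%N) xk]; have /andP[_ h] := H_itv 0 k.
by rewrite -(@ler_pM2l _ k%:R) ?ltr0n// mulr1; exact: le_trans xk h.
Qed.

Let slopes0 : slopes 0.
Proof. by exists 1%N => // n; rewrite mulr0; case/andP: (H_itv n 1). Qed.

Let t01 : 0 <= t <= 1.
Proof.
apply/andP; split; first by apply: ub_le_sup => //; exists 1.
by apply: ge_sup => //; exists 0.
Qed.

(** Otherwise, by integrality, every window of length [k] has at most some [p < k%:R * t] digits 1,
    which bounds all of [slopes] by [p / k%:R < t]. *)
Let window_ge k : exists n, k%:R * t <= H n k.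
Proof.
have [->|k0] := posnP k; first by exists 0%N; rewrite mul0r H0.
apply: contrapT => /forallNP h.
have {}h n : H n k <= (Num.ceil (k%:R * t))%:~R - 1.
  have [_ h2] := ceiP (k%:R * t); have /negP := h n; rewrite -ltNge => h3.
  rewrite -(lerD2r 1) subrK -int_num_lt ?intr_int//.
  by apply: lt_le_trans h3 _; case: (ceiP (k%:R * t)).
have [_ h2] := ceiP (k%:R * t).
move: h; set p := _ - 1 => h; have {}h2 : p < k%:R * t by rewrite /p; lra.
have : t <= p / k%:R.
  apply: ge_sup; first by exists 0.
  move=> x [j j0 xj]; rewrite ler_pdivlMr ?ltr0n//.
  (* A window of length [j * k] is cut both into pieces of length [j] and into pieces of length
     [k]. *)
  have := H_windows_ge k 0 xj; have := H_windows_le j 0 h.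
  rewrite mulnC => /[swap] /le_trans /[apply].
  by rewrite mulrCA ler_pM2l ?ltr0n// mulrC.
by rewrite ler_pdivlMr ?ltr0n// mulrC => h3; have := lt_le_trans h2 h3; rewrite ltxx.
Qed.

(** Otherwise, by integrality, [(flr (k%:R * t) + 1) / k%:R > t] would belong to [slopes]. *)
Let window_le k : exists n, H n k <= k%:R * t.
Proof.
have [->|k0] := posnP k; first by exists 0%N; rewrite mul0r H0.
apply: contrapT => /forallNP h.
have [_ h2] := flrP (k%:R * t).
have {}h n : (Num.floor (k%:R * t))%:~R + 1 <= H n k.
  have [h3 _] := flrP (k%:R * t); have /negP := h n; rewrite -ltNge => h4.
  by rewrite -int_num_lt ?intr_int//; exact: le_lt_trans h4.
have : ((Num.floor (k%:R * t))%:~R + 1) / k%:R <= t.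
  apply: ub_le_sup; first by exists 1.
  by exists k => // n; rewrite mulrC divfK ?pnatr_eq0 -?lt0n.
by rewrite ler_pdivrMr ?ltr0n// [t * _]mulrC leNgt h2.
Qed.

(** Of two positions, the one with the larger tail value serves for the lengths of both, by
    [H_mono]. *)
Let windows_ge N : exists n, forall k, (k <= N)%N -> k%:R * t <= H n k.
Proof.
elim: N => [|N [n h]].
  by exists 0%N => k; rewrite leqn0 => /eqP ->; rewrite mul0r H0.
have [n' h'] := window_ge N.+1.
have [le|/ltW le] := leP (bval b (shift n v)) (bval b (shift n' v)).
  exists n' => k; rewrite leq_eqVlt ltnS => /predU1P[->//|kN].
  exact: le_trans (h k kN) (H_mono k le).
exists n => k; rewrite leq_eqVlt ltnS => /predU1P[->|/h//].
exact: le_trans h' (H_mono _ le).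
Qed.

Let windows_le N : exists n, forall k, (k <= N)%N -> H n k <= k%:R * t.
Proof.
elim: N => [|N [n h]].
  by exists 0%N => k; rewrite leqn0 => /eqP ->; rewrite mul0r H0.
have [n' h'] := window_le N.+1.
have [le|/ltW le] := leP (bval b (shift n v)) (bval b (shift n' v)).
  exists n => k; rewrite leq_eqVlt ltnS => /predU1P[->|/h//].
  exact: le_trans (H_mono _ le) h'.
exists n' => k; rewrite leq_eqVlt ltnS => /predU1P[->//|kN].
exact: le_trans (H_mono k le) (h k kN).
Qed.

(** A position with all counts at most [k%:R * t] is dominated by the lower word, and its tail value
    exceeds [kappa]. A position with all counts at least [k%:R * t] starts with 1; after this 1 its
    counts dominate those of the upper word, while its value is below [c]. *)
Lemma exists_rotation_number : exists s, [/\ 0 < s <= 1,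
  bval b (upper_word s) <= c & kappa <= bval b (lower_word s)].
Proof.
have low : kappa <= bval b (lower_word t).
  apply/ler_addgt0Pr => e e0; have [N eN] := exists_small_expr b1 e0.
  have [n h] := windows_le N.
  have := @bval_le_near _ b b1 (shift n v) (lower_word t)
    (fun k => v_unit _) (fun k => lower_unit k t01) N.
  suff H' k : (k <= N)%N -> series (shift n v) k <= series (lower_word t) k.
    by move=> /(_ H'); have := lb_tail n; lra.
  move=> /h; rewrite series_lower -/(H n k).
  have /intrP[i ->] := H_int n k.
  by rewrite -floor_ge_int ler_int.
have t0 : 0 < t.
  rewrite lt_neqAle andbC; have /andP[-> _] := t01.
  apply/eqP => t0; move: low; rewrite -t0 lower_word0.
  by rewrite bval_cst// mul0r leNgt kappa0.
have t1 : t <= 1 by case/andP: t01.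
exists t; rewrite t0 t1; split => //.
apply/ler_addgt0Pr => e e0; have [N eN] := exists_small_expr b1 e0.
have [n h] := windows_ge N.+1.
have vn : v n = 1.
  case: (v01 n) => // vn; have := h 1%N isT.
  by rewrite HS H0 addn0 vn mul1r addr0 leNgt t0.
have := @bval_le_near _ b b1 (upper_word t) (shift n.+1 v)
  (fun k => upper_unit k t01) (fun k => v_unit _) N.
suff H' k : (k <= N)%N -> series (upper_word t) k <= series (shift n.+1 v) k.
  by move=> /(_ H'); have := tail1 vn; lra.
move=> kN; rewrite series_upper ?t0 ?t1//.
have := h k.+1 kN; rewrite -add1n HD HS H0 addn0 vn add0r addn1 add1n -/(H _ _).
have /intrP[i ->] := H_int n.+1 k.
by rewrite -[1]/(1%:~R) -intrD -ceil_le_int -intrB ler_int lerBlDl.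
Qed.

End RotationNumber.

(** * The golden ratio in terms of plateaux *)

Section GoldenRatio.
Context {R : realType}.
Implicit Types (b m t : R) (n k : nat).

(** The floor is superadditive. *)
Lemma lower_word_tail_ge b t n : 1 < b -> 0 <= t <= 1 ->
  bval b (lower_word t) <= bval b (shift n (lower_word t)).
Proof.
move=> b1 t01; apply: bval_le_partial => // k; try exact: lower_unit.
rewrite series_shift !series_lower natrD mulrDl.
have [h1 _] := flrP (n%:R * t); have [h2 _] := flrP (k%:R * t).
have [_ h3] := flrP (n%:R * t + k%:R * t).
have := @int_num_lt R (Num.floor (n%:R * t + k%:R * t))%:~R
  ((Num.floor (n%:R * t))%:~R + (Num.floor (k%:R * t))%:~R).
by rewrite rpredD ?intr_int// => /(_ isT isT); lra.
Qed.

(** The floor of [x + y] is at most [flr x + cei y]; the digit 1 at [n] accounts for the [- 1] in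
    the partial sums of the upper word. *)
Lemma lower_word_tail_le b t n : 1 < b -> 0 < t <= 1 -> lower_word t n = 1 ->
  bval b (shift n.+1 (lower_word t)) <= bval b (upper_word t).
Proof.
move=> b1 t01 tn; apply: bval_le_partial => // k.
- by apply: lower_unit; lra.
- by apply: upper_unit; lra.
rewrite series_shift series_upper// !series_lower.
move: tn; rewrite /lower_word addSnnS natrD mulrDl => tn.
have [_ h1] := flrP (n%:R * t); have [h2 _] := ceiP (k.+1%:R * t).
have [h3 _] := flrP (n%:R * t + k.+1%:R * t).
have := @int_num_lt R
  ((Num.floor (n%:R * t))%:~R + (Num.ceil (k.+1%:R * t))%:~R)
  (Num.floor (n%:R * t + k.+1%:R * t))%:~R.
by rewrite rpredD ?intr_int// => /(_ isT isT); lra.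
Qed.

(** After a digit 0 the other digits fail because all tails are below 1 for [b > 2]. After a digit 1
    the digits 0 and [m] fail by the two bounds, which reach every such tail through the two
    preceding inequalities. *)
Lemma lower_word_univoque m b t : 1 < m <= 2 -> 2 < b -> 0 < t <= 1 ->
  bval b (upper_word t) < m - 1 -> m / (b - 1) - 1 < bval b (lower_word t) ->
  univoque b (ternary m) (lower_word t).
Proof.
move=> m12 b2 t01 tU tL; have b1 : 1 < b by lra.
apply: univoque_of_digits => //; first lra.
  move=> k; apply/ternaryP.
  by case: (@lower_binary _ t k) => [||]; [lra|constructor 1|constructor 2].
move=> n a /ternaryP aA an.
have tge := @lower_word_tail_ge b t n.+1 b1 ltac:(lra).
have lt1 : bval b (shift n.+1 (lower_word t)) < 1.
  have u01 k : 0 <= shift n.+1 (lower_word t) k <= 1 by apply: lower_unit; lra.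
  apply: le_lt_trans (bval_le b1 u01) _.
  by rewrite ltr_pdivrMr; lra.
case: (@lower_binary _ t n) => [|e|e]; first lra.
  by rewrite e in an *; case: aA an => -> an; lra.
have := lower_word_tail_le b1 t01 e.
by rewrite e in an *; case: aA an => -> an; lra.
Qed.

Lemma lower_word_nontrivial m t : 1 < m -> 0 < t <= 1 ->
  ~ trivial_sequences (ternary m) (lower_word t).
Proof.
move=> m1 t01; rewrite trivial_sequences_ternary// => -[] E.
  pose k := Num.truncn (1 / t); have tk : 1 <= k.+1%:R * t.
    have : 1 / t < k.+1%:R by apply: truncnS_gt.
    by rewrite ltr_pdivrMr; [exact: ltW|lra].
  have := series_lower t k.+1; rewrite E /series/= big1//.
  have : (1 : int) <= Num.floor (k.+1%:R * t) by rewrite floor_ge_int.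
  move=> h /esym/eqP; rewrite intr_eq0 => /eqP h0.
  by rewrite h0 in h.
have := congr1 (fun f => f 0%N) E; rewrite /cst.
by case: (@lower_binary _ t 0) => [|->|->]; lra.
Qed.

Lemma exists_nontrivial_univoque m b : 1 < m <= 2 -> 1 < b ->
  m < (b - 1) ^+ 2 -> exists2 u, univoque b (ternary m) u &
    ~ trivial_sequences (ternary m) u.
Proof.
move=> m12 b1; rewrite expr2 => bm; have b2 : 2 < b by nra.
have KE : m / (b - 1) * (b - 1) = m by field; lra.
(* With [K = m / (b - 1)], the shifted lower word must exceed [b * (K - 1) = K + m - b], which is
   below [m - 1] exactly when [m < (b - 1) ^+ 2]. The maximum with 0 makes the cut positive. *)
pose q := Num.max 0 (b * (m / (b - 1) - 1)).
have q0 : 0 <= q by rewrite le_max lexx.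
have qb : b * (m / (b - 1) - 1) <= q by rewrite le_max lexx orbT.
have qm : q < m - 1.
  rewrite gt_max; apply/andP; split; first lra.
  move: (m / (b - 1)) KE => K KE; nra.
have [|t [t01 tU tL]] := @exists_slope _ b ((q + (m - 1)) / 2) b1; first lra.
exists (lower_word t); last by apply: lower_word_nontrivial => //; lra.
apply: lower_word_univoque => //; first lra.
case: tL => [->|[t1 tL]].
  rewrite lower_word1 bval_cst//; move: (m / (b - 1)) KE => K KE.
  have : 1 / (b - 1) * (b - 1) = 1 by field; lra.
  by move: (1 / (b - 1)) => x; nra.
by rewrite bval_lower ?ltr_pdivlMr 1?mulrC; lra.
Qed.

(** These are the two bounds of the criterion above in base [1 + Num.sqrt m], where
    [m / (b - 1) = Num.sqrt m]. *)
Definition plateau m t := bval (1 + Num.sqrt m) (upper_word t) < m - 1 /\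
  Num.sqrt m - 1 < bval (1 + Num.sqrt m) (lower_word t).

Lemma sqrt_itv m : 1 < m <= 2 ->
  1 < Num.sqrt m < 2 /\ Num.sqrt m * Num.sqrt m = m.
Proof.
move=> m12; have sE : Num.sqrt m * Num.sqrt m = m.
  by rewrite -expr2 sqr_sqrtr; lra.
split=> //; have := sqrtr_ge0 m; move: sE; move: (Num.sqrt m) => s; nra.
Qed.

Lemma plateau_univoque m t : 1 < m <= 2 -> 0 < t <= 1 -> plateau m t ->
  exists2 b, 1 < b < 1 + Num.sqrt m & exists2 u, univoque b (ternary m) u &
    ~ trivial_sequences (ternary m) u.
Proof.
move=> m12 t01 [hU hL].
have [s12 sE] := sqrt_itv m12; move: hU hL s12 sE.
move: (Num.sqrt m) => s hU hL s12 sE.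
have s0 : 0 < s by lra.
have sV : s^-1 < 1 by rewrite invf_lt1; lra.
have sVE : m * s^-1 = s by rewrite -sE mulfK// gt_eqF.
set gU := m - 1 - bval (1 + s) (upper_word t).
set gL := bval (1 + s) (lower_word t) - (s - 1).
(* The base is lowered so that [(b - 1)^-1] grows from [s^-1] by [r]. Then the upper value grows by
   at most [r], the lower threshold by [m * r <= 2 * r], and [s^-1 + r < 1] keeps [b > 2]. *)
pose r := Num.min (1 - s^-1) (Num.min gU gL) / 3.
have gU0 : 0 < gU by rewrite /gU; lra.
have gL0 : 0 < gL by rewrite /gL; lra.
have /and3P[r1 r2 r3] : [&& 3 * r <= 1 - s^-1, 3 * r <= gU & 3 * r <= gL].
  by rewrite -!le_min mulrC divfK.
have r0 : 0 < r by rewrite divr_gt0// !lt_min gU0 gL0; lra.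
have sV0 : 0 < s^-1 by rewrite invr_gt0.
pose b := 1 + (s^-1 + r)^-1.
have bV : (b - 1)^-1 = s^-1 + r by rewrite /b addrC addKr invrK.
have bs : b < 1 + s by rewrite ltrD2l -[ltRHS]invrK ltf_pV2 ?posrE; lra.
have b2 : 2 < b.
  have : 1 < (s^-1 + r)^-1 by rewrite invf_gt1; lra.
  by rewrite /b; lra.
exists b; first lra.
exists (lower_word t); last by apply: lower_word_nontrivial => //; lra.
have b1 : 1 < b by lra.
have U01 k : 0 <= upper_word t k <= 1 by apply: upper_unit; lra.
have L01 k : 0 <= lower_word t k <= 1 by apply: lower_unit; lra.
apply: lower_word_univoque => //.
  have := bval_lipschitz b1 (ltW bs) U01.
  by rewrite bV [1 + s - 1]addrAC subrr add0r; rewrite /gU in r2; lra.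
have := bval_antitone b1 (ltW bs) L01.
by rewrite bV mulrDr sVE; rewrite /gL in r3; nra.
Qed.

Lemma univoque_plateau m b u : 1 < m <= 2 -> 1 < b < 1 + Num.sqrt m ->
  univoque b (ternary m) u -> ~ trivial_sequences (ternary m) u ->
  exists2 t, 0 < t <= 1 & plateau m t.
Proof.
move=> m12; have [s12 sE] := sqrt_itv m12; rewrite /plateau.
move: (Num.sqrt m) s12 sE => s s12 sE b1s uu.
rewrite trivial_sequences_ternary; last lra.
move=> /not_orP[u0 um].
have b1 : 1 < b by lra.
have bs : b < 1 + s by lra.
have bm : (b - 1) ^+ 2 < m by rewrite expr2; nra.
have [v [b2 v01 vK v1 v0]] := univoque_binary_tail m12 b1 bm uu u0 um.
have KE : m / (b - 1) * (b - 1) = m by field; lra.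
have K0 : 0 < m / (b - 1) - 1.
  by rewrite expr2 in bm; move: (m / (b - 1)) KE => K; nra.
have [t [t01 tU tL]] := exists_rotation_number b2 K0 v01 vK v1 v0.
exists t => //.
have U01 k : 0 <= upper_word t k <= 1 by apply: upper_unit; lra.
have L01 k : 0 <= lower_word t k <= 1 by apply: lower_unit; lra.
split.
  have := bvalM_antitone b1 (ltW bs) U01.
  have : 0 <= bval (1 + s) (upper_word t) by apply: bval_ge0 U01; lra.
  by nra.
have := bval_lipschitz b1 (ltW bs) L01; rewrite [1 + s - 1]addrAC subrr add0r.
have : s^-1 < (b - 1)^-1 by rewrite ltf_pV2 ?posrE; lra.
have sVE : m * s^-1 = s by rewrite -sE mulfK// gt_eqF//; lra.
by move: tL; move: s^-1 (b - 1)^-1 sVE => x y sVE; nra.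
Qed.

Lemma golden_ratioP m : 1 < m <= 2 ->
  golden_ratio (ternary m) = 1 + Num.sqrt m <->
  forall t, 0 < t <= 1 -> ~ plateau m t.
Proof.
move=> m12; have [s12 sE] := sqrt_itv m12; split.
  move=> g t t01 /(plateau_univoque m12 t01)[b b1 [u uu]]; apply.
  have : is_golden_ratio (ternary m) (1 + Num.sqrt m).
    move: g; rewrite /golden_ratio; case: xgetP => [g -> gA <-//|_ g].
    by move: g s12; lra.
  by move=> [_ h _]; rewrite -(h b b1).
move=> h; have gA : is_golden_ratio (ternary m) (1 + Num.sqrt m).
  split=> [|b b1|b b1]; first lra.
  - apply/seteqP; split=> u.
      move=> uu; apply: contrapT => /(univoque_plateau m12 b1 uu)[t t01].
      exact: h.
    rewrite trivial_sequences_ternary; last lra.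
    by case=> ->; [apply: univoque_cst0|apply: univoque_cstm]; lra.
  - by apply: exists_nontrivial_univoque => //; rewrite ?expr2; nra.
by apply: xget_unique => // g /is_golden_ratio_unique; apply.
Qed.

End GoldenRatio.

Section CriticalAlphabets.
Context {R : realType}.
Implicit Types (m t : R) (d : nat -> R) (n k N : nat).

Definition crit d m : R := bval (1 + Num.sqrt m) d.

Lemma sqrt_lipschitz m m' : 1 <= m -> m <= m' ->
  0 <= Num.sqrt m' - Num.sqrt m <= (m' - m) / 2.
Proof.
move=> m1 mm'; have := ler_wsqrtr mm'; have := ler_wsqrtr m1; rewrite sqrtr1.
have := @sqr_sqrtr _ m ltac:(lra); have := @sqr_sqrtr _ m' ltac:(lra).
by rewrite !expr2; move: (Num.sqrt m) (Num.sqrt m') => s s'; nra.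
Qed.

Lemma crit_base m : 1 <= m -> 1 < 1 + Num.sqrt m.
Proof. by move=> m1; rewrite ltrDl sqrtr_gt0; lra. Qed.

Lemma crit_lipschitz d m m' : (forall k, 0 <= d k <= 1) -> 1 <= m -> m <= m' ->
  0 <= crit d m - crit d m' <= (m' - m) / 2.
Proof.
move=> d01 m1 mm'; have /andP[s0 s1] := sqrt_lipschitz m1 mm'.
have b1 := crit_base m1.
have bb' : 1 + Num.sqrt m <= 1 + Num.sqrt m' by lra.
have := bval_antitone b1 bb' d01; have := bval_lipschitz b1 bb' d01.
rewrite -/(crit d m) -/(crit d m') !(addrAC 1 _ (-1)) subrr !add0r.
have := ler_wsqrtr m1; rewrite sqrtr1.
move: s0 s1; move: (Num.sqrt m) (Num.sqrt m') => s s' s0 s1 s2.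
have -> : s^-1 - s'^-1 = (s' - s) / (s * s') by field; rewrite !gt_eqF//; lra.
have : (s' - s) / (s * s') <= s' - s.
  have s'1 : 1 <= s' by lra.
  by rewrite ler_pdivrMr ?ler_peMr ?mulr_ege1// mulr_gt0//; lra.
lra.
Qed.

Lemma crit_antitone d m m' : (forall k, 0 <= d k <= 1) -> 1 <= m -> m <= m' ->
  crit d m' <= crit d m.
Proof. by move=> d01 m1 mm'; have := crit_lipschitz d01 m1 mm'; lra. Qed.

Lemma crit_solution d : (forall k, 0 <= d k <= 1) -> (exists j, 0 < d j) ->
  exists2 m, 1 < m < 2 & crit d m = m - 1.
Proof.
move=> d01 [j dj]; pose S := [set m | 1 <= m <= 2 /\ m - 1 <= crit d m].
have gt0 m : 1 <= m -> 0 < crit d m.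
  by move=> m1; exact: (bval_gt0 (crit_base m1) d01 dj).
have S1 : S 1 by split; [lra|rewrite subrr ltW ?gt0].
have Sub : ubound S 2 by move=> x [] /andP[].
have supS : has_sup S by split; [exists 1|exists 2].
pose m := sup S.
have m1 : 1 <= m by apply: ub_le_sup => //; exists 2.
have m2 : m <= 2 by apply: ge_sup => //; exists 1.
have le : m - 1 <= crit d m.
  apply/ler_addgt0Pr => e e0; have e2 : 0 < e / 2 by lra.
  have [x [x12 xd] mx] := sup_adherent e2 supS.
  have xm : x <= m by apply: ub_le_sup => //; exists 2.
  have x1 : 1 <= x by case/andP: x12.
  by have := crit_lipschitz d01 x1 xm; rewrite -/m in mx; lra.
have {}m2 : m < 2.
  rewrite lt_neqAle m2 andbT; apply/eqP => E; move: le; rewrite E.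
  have le12 : (1 : R) <= 2 by lra.
  have := bval_le (crit_base le12) d01.
  rewrite -/(crit d 2) addrAC subrr add0r div1r.
  have [s12 sE] := @sqrt_itv R 2 ltac:(lra).
  have : (Num.sqrt 2)^-1 < 1 :> R by rewrite invf_lt1; lra.
  lra.
have E : crit d m = m - 1.
  apply/eqP; rewrite eq_le le andbT; apply/ler_addgt0Pr => e e0.
  pose e' := Num.min (e / 2) (2 - m).
  have /andP[e'1 e'2] : (e' <= e / 2) && (e' <= 2 - m) by rewrite -le_min.
  have e'0 : 0 < e' by rewrite lt_min; lra.
  have mm : m <= m + e' by lra.
  have := crit_lipschitz d01 m1 mm.
  suff : crit d (m + e') < m + e' - 1 by lra.
  rewrite ltNge; apply/negP => h.
  have : m + e' <= m by apply: ub_le_sup => //; [exists 2|split=> //; lra].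
  lra.
exists m => //; rewrite m2 andbT lt_neqAle m1 andbT; apply/eqP => m_1.
by have := gt0 m m1; rewrite E -m_1 subrr ltxx.
Qed.

Lemma crit_solution_lt d e m m' : (forall k, 0 <= e k <= 1) -> 1 <= m -> 1 <= m' ->
  crit d m = m - 1 -> crit e m' = m' - 1 -> crit d m < crit e m -> m < m'.
Proof.
move=> e01 m1 m'1 dE eE de; rewrite ltNge; apply/negP => m'm.
by have := crit_antitone e01 m'1 m'm; lra.
Qed.

Lemma frakMP m : frakM R m <->
  1 < m <= 2 /\ forall t, 0 < t <= 1 -> ~ plateau m t.
Proof. by split=> -[m12 /(golden_ratioP m12)]. Qed.

Local Notation upper t := (@upper_word R t).
Local Notation lower1 t := (shift 1 (@lower_word R t)).

Let U01 t k : 0 < t <= 1 -> 0 <= upper t k <= 1.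
Proof. by move=> ?; apply: upper_unit; lra. Qed.

Let L01 t k : 0 <= t <= 1 -> 0 <= lower1 t k <= 1.
Proof. by move=> ?; apply: lower_unit; lra. Qed.

Lemma plateauE m t : 1 < m <= 2 -> 0 < t < 1 ->
  plateau m t <-> crit (upper t) m < m - 1 < crit (lower1 t) m.
Proof.
move=> m12 t01; have [s12 sE] := sqrt_itv m12.
rewrite /plateau bval_lower; [|by apply: crit_base; lra|lra].
rewrite ltr_pdivlMr; last lra.
rewrite (_ : (Num.sqrt m - 1) * (1 + Num.sqrt m) = m - 1); last by rewrite -{3}sE; ring.
by split=> [[-> ->]|/andP].
Qed.

(* The words c such that 0c and 1c are limits of mechanical words of slope t. *)
Definition mechanical t d := 0 < t <= 1 /\
  (d = upper t \/ t < 1 /\ d = lower1 t).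

Lemma mechanical_unit t d k : mechanical t d -> 0 <= d k <= 1.
Proof. by move=> [t01 [->|[t1 ->]]]; [apply: U01|apply: L01; lra]. Qed.

Lemma mechanical_lt b t t' d d' : 1 < b -> mechanical t d -> mechanical t' d' ->
  t < t' -> bval b d < bval b d'.
Proof.
move=> b1 [t01 hd] [t'01 hd'] tt'.
have lt : bval b d < bval b (upper t').
  by case: hd => [->|[t1 ->]]; [apply: bval_upper_lt|apply: bval_lower_lt_upper] => //; lra.
apply: lt_le_trans lt _; case: hd' => [->//|[t1 ->]].
by apply: bval_upper_le_lower => //; lra.
Qed.

Lemma frakM_slope m : frakM R m ->
  exists t d, mechanical t d /\ crit d m = m - 1.
Proof.
move=> /frakMP[m12 h]; have [s12 sE] := sqrt_itv m12.
have b1 := crit_base (ltac:(lra) : 1 <= m).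
have [|t [t01 tU tL]] := @exists_slope _ _ (m - 1) b1; first lra.
exists t; move: tU; rewrite le_eqVlt => /predU1P[tU|tU].
  by exists (upper t); split=> //; split=> //; left.
case: tL => [t1|[t1 tL]].
  case: (h t t01); split => //; rewrite t1.
  rewrite lower_word1 bval_cst// addrAC subrr add0r ltr_pdivlMr; last lra.
  by move: (Num.sqrt m) s12 sE {b1 tU} => s; nra.
exists (lower1 t); split; first by split=> //; right.
apply/eqP; rewrite eq_le tL andbT leNgt; apply/negP => h'.
by apply: (h t t01); apply/plateauE => //; [lra|rewrite tU].
Qed.

Lemma upper_frakM m t : 1 < m <= 2 -> 0 < t <= 1 ->
  crit (upper t) m = m - 1 -> frakM R m.
Proof.
move=> m12 t01 tE; have b1 := crit_base (ltac:(lra) : 1 <= m).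
apply/frakMP; split=> // s s01 [sU sL].
have [st|ts|st] := ltgtP s t; last by move: sU; rewrite st -/(crit _ _) tE ltxx.
- have s1 : 0 < s < 1 by lra.
  have [/(_ (conj sU sL))/andP[_] + _] := plateauE m12 s1; rewrite -tE.
  have : crit (lower1 s) m < crit (upper t) m.
    by apply: bval_lower_lt_upper => //; lra.
  lra.
- have : crit (upper t) m < crit (upper s) m by apply: bval_upper_lt => //; lra.
  by have : crit (upper s) m < m - 1 := sU; lra.
Qed.

Lemma mechanical_gt0 t d : mechanical t d -> exists j, 0 < d j.
Proof.
move=> td; have [t01 _] := td; apply: contrapT => /forallNP h.
have {}h : d = cst 0.
  apply/funext => j; have := h j; have := mechanical_unit j td; rewrite /cst => ? /negP; lra.
have t2 : mechanical (t / 2) (upper (t / 2)) by split; [lra|left].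
have := @mechanical_lt 2 _ _ _ _ ltac:(lra) t2 td ltac:(lra).
rewrite h bval_cst; last lra.
by have := @bval_upper_ge0 _ 2 ltac:(lra) (t / 2) ltac:(lra); lra.
Qed.

Lemma mechanical_solution t d : mechanical t d ->
  exists2 m, 1 < m < 2 & crit d m = m - 1.
Proof.
by move=> td; apply: crit_solution (mechanical_gt0 td) => k; apply: mechanical_unit td.
Qed.

Lemma upper_mechanical t : 0 < t <= 1 -> mechanical t (upper t).
Proof. by split=> //; left. Qed.

Lemma frakM_uncountable : ~ countable (frakM R).
Proof.
pose slope m := xget (0 : R) [set t | 0 < t <= 1 /\ crit (upper t) m = m - 1].
have slopeE m t : 1 <= m -> 0 < t <= 1 -> crit (upper t) m = m - 1 -> slope m = t.
  move=> m1 t01 tE; apply: xget_unique => //= s [s01 sE].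
  have lt := @mechanical_lt _ _ _ _ _ (crit_base m1).
  have [st|ts|//] := ltgtP s t.
    by have := lt _ _ _ _ (upper_mechanical s01) (upper_mechanical t01) st; rewrite -!/(crit _ _) sE tE ltxx.
  by have := lt _ _ _ _ (upper_mechanical t01) (upper_mechanical s01) ts; rewrite -!/(crit _ _) sE tE ltxx.
move=> cM; have : countable (`]0, 1]%classic : set R).
  apply: sub_countable (sub_countable (card_image_le slope _) cM).
  apply: subset_card_le => t /=; rewrite in_itv/= => t01.
  have [m m12 mE] := mechanical_solution (upper_mechanical t01).
  exists m; first by apply: upper_frakM mE => //; lra.
  by apply: slopeE => //; lra.
move=> /countable_lebesgue_measure0; rewrite lebesgue_measure_itv/= lte_fin ltr01.
by move=> /eqP; rewrite -EFinB eqe subr0 oner_eq0.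
Qed.

Lemma frakM_closed : exists2 F : set R, closed F &
  frakM R = [set m : R | 1 < m <= 2] `&` F.
Proof.
pose O : set R := [set m : R | 1 < m /\ exists2 t, 0 < t <= 1 & plateau m t].
exists (~` O); last first.
  apply/seteqP; split=> [m /frakMP[m12 h]|m [/= m12 mO]].
    by split=> // -[_ [t t01]]; exact: h.
  by apply/frakMP; split=> // t t01 h; apply: mO; split; [lra|exists t].
apply: open_closedC; rewrite openE => m [m1 [t t01 [hU hL]]].
have l01 k : 0 <= lower_word t k <= 1 by apply: lower_unit; lra.
pose gU := m - 1 - crit (upper t) m.
pose gL := crit (lower_word t) m - (Num.sqrt m - 1).
have gU0 : 0 < gU by rewrite /gU; move: hU; rewrite -/(crit _ _); lra.
have gL0 : 0 < gL by rewrite /gL; move: hL; rewrite -/(crit _ _); lra.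
pose e := Num.min (m - 1) (Num.min (gU / 2) gL).
apply/nbhs_ballP; exists e => /=; first by rewrite !lt_min; lra.
move=> x /=; rewrite /ball/= !lt_min => /and3P[].
rewrite !ltr_norml => x1 x2 x3; split; first lra.
exists t => //; rewrite /plateau -/(crit _ _) -/(crit _ _).
have [mx|xm] := leP m x.
  have := sqrt_lipschitz (ltW m1) mx.
  have := crit_lipschitz (fun k => U01 k t01) (ltW m1) mx.
  have := crit_lipschitz l01 (ltW m1) mx.
  by rewrite /gU /gL in x2 x3 *; split; lra.
have x1' : 1 <= x by lra.
have := sqrt_lipschitz x1' (ltW xm).
have := crit_lipschitz (fun k => U01 k t01) x1' (ltW xm).
have := crit_lipschitz l01 x1' (ltW xm).
by rewrite /gU /gL in x2 x3 *; split; lra.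
Qed.

Lemma plateau_between m m' : m < m' -> frakM R m -> frakM R m' ->
  exists2 x, m < x < m' & ~ frakM R x.
Proof.
move=> mm' Mm Mm'; have [m12 _] := (frakMP m).1 Mm; have [m'12 _] := (frakMP m').1 Mm'.
have [t [d [td dE]]] := frakM_slope Mm; have [t' [d' [td' dE']]] := frakM_slope Mm'.
have gap s y z : 0 < s < 1 -> m <= y -> y < z -> z <= m' ->
    crit (upper s) y <= y - 1 -> z - 1 <= crit (lower1 s) z ->
    exists2 x, m < x < m' & ~ frakM R x.
  move=> s01 my yz zm' hy hz; exists ((y + z) / 2); first lra.
  move=> /frakMP[x12 /(_ s ltac:(lra))]; apply; apply/plateauE => //.
  have U k : 0 <= upper s k <= 1 by apply: U01; lra.
  have L k : 0 <= lower1 s k <= 1 by apply: L01; lra.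
  have y1 : 1 <= y by lra. have x1 : 1 <= (y + z) / 2 by lra.
  have yx : y <= (y + z) / 2 by lra. have xz : (y + z) / 2 <= z by lra.
  by have := crit_antitone U y1 yx; have := crit_antitone L x1 xz; lra.
have m1 : 1 <= m by lra. have m'1 : 1 <= m' by lra.
have [tt'|t't|tt'] := ltgtP t t'.
- have [q] := rat_in_itvoo tt'; rewrite in_itv/=; set r := ratr q => tr.
  have [t01 _] := td; have [t'01 _] := td'.
  have r01 : 0 < r < 1 by lra.
  have mU : mechanical r (upper r) by split; [lra|left].
  have mL : mechanical r (lower1 r) by split; [lra|right; split=> //; lra].
  have [y y12 yE] := mechanical_solution mU.
  have [z z12 zE] := mechanical_solution mL.
  have y1 : 1 <= y by lra. have z1 : 1 <= z by lra.
  apply: (gap r y z) => //; rewrite ?yE ?zE//.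
  + apply: ltW; apply: (@crit_solution_lt d (upper r)) => //.
      by move=> k; apply: mechanical_unit mU.
    by apply: (@mechanical_lt _ t r) => //; [apply: crit_base|lra].
  + apply: (@crit_solution_lt (upper r) (lower1 r)) => //.
      by move=> k; apply: mechanical_unit mL.
    apply: (@bval_upper_lt_lower _ _ _ _ `|denq q|.-1) => //; first exact: crit_base.
    have dq : (0 < `|denq q|)%N by rewrite absz_gt0 denq_neq0.
    rewrite prednK// /r /ratr mulrCA.
    rewrite natr_absz gtr0_norm ?denq_gt0// mulfV ?mulr1 ?intr_int//.
    by rewrite intr_eq0 denq_neq0.
  + apply: ltW; apply: (@crit_solution_lt (lower1 r) d') => //.
      by move=> k; apply: mechanical_unit td'.
    by apply: (@mechanical_lt _ r t') => //; [apply: crit_base|lra].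
- have /(_ _)/ltW := @crit_solution_lt d' d m' m (fun k => mechanical_unit k td) m'1 m1 dE' dE.
  by rewrite leNgt mm' => /(_ (mechanical_lt (crit_base m'1) td' td t't)).
- subst t'; have ne : d <> d'.
    move=> dd'; subst d'.
    by have := crit_antitone (fun k => mechanical_unit k td) m1 (ltW mm'); lra.
  case: td td' => t01 [dt|[t1 dt]] [_ [dt'|[t1' dt']]]; subst d d' => //.
    by apply: (gap t m m') => //; rewrite ?dE ?dE'//; lra.
  have := @bval_upper_le_lower _ _ (crit_base m'1) t ltac:(lra).
  rewrite -!/(crit _ _) dE'.
  have := crit_antitone (fun k => L01 k (ltac:(lra) : 0 <= t <= 1)) m1 (ltW mm').
  by rewrite dE; lra.
Qed.

Lemma frakM_interior : (frakM R)^° = set0.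
Proof.
apply/seteqP; split => // x /nbhs_ballP[e /= e0 xe].
have inM y : x - e < y < x + e -> frakM R y.
  by move=> xy; apply: xe; rewrite /ball/= ltr_norml; lra.
have [|||y y12] := @plateau_between x (x + e / 2); first lra.
- by apply: inM; lra.
- by apply: inM; lra.
by apply; apply: inM; lra.
Qed.

Lemma frakM_isolated : isolated (frakM R) = set0.
Proof.
apply/seteqP; split => // m [/set_mem Mm [V /nbhs_ballP[e /= e0 mV] VM]].
suff [x [mx xm Mx]] : exists x, [/\ x != m, `|m - x| < e & frakM R x].
  have : (V `&` frakM R) x by split=> //; apply: mV.
  by rewrite VM => xE; rewrite xE eqxx in mx.
have [m12 _] := (frakMP m).1 Mm; have m1 : 1 <= m by lra.
have [t [d [td dE]]] := frakM_slope Mm.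
have [N eN] := exists_small_expr (crit_base m1) e0.
have d01 k : 0 <= d k <= 1 by apply: mechanical_unit td.
case: td => t01 [E|[t1 E]]; rewrite {}E in dE d01.
  have [x x0 h] := upper_word_left N t01.
  have [|t'0 {}h] := h (t - x / 2); first lra.
  have t'01 : 0 < t - x / 2 <= 1 by lra.
  have [y y12 yE] := mechanical_solution (upper_mechanical t'01); have y1 : 1 <= y by lra.
  have ym : y < m.
    apply: (crit_solution_lt d01 y1 m1 yE dE).
    by apply: bval_upper_lt; rewrite ?crit_base//; lra.
  exists y; split; first by rewrite lt_eqF.
    rewrite ger0_norm; last lra.
    have := crit_antitone (fun k => U01 k t'01) y1 (ltW ym).
    have := bval_near (crit_base m1) d01 (fun k => U01 k t'01) (fun k kN => esym (h k kN)).
    by rewrite -!/(crit _ _); lra.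
  by apply: upper_frakM yE => //; lra.
have [x x0 h] := @upper_word_right _ t N ltac:(lra).
have [|t'0 {}h] := h (t + x / 2); first lra.
have t'01 : 0 < t + x / 2 <= 1 by lra.
have [y y12 yE] := mechanical_solution (upper_mechanical t'01); have y1 : 1 <= y by lra.
have my : m < y.
  apply: (crit_solution_lt (fun k => U01 k t'01) m1 y1 dE yE).
  by apply: bval_lower_lt_upper; rewrite ?crit_base//; lra.
exists y; split; first by rewrite gt_eqF.
  rewrite ler0_norm; last lra.
  have := crit_antitone (fun k => U01 k t'01) m1 (ltW my).
  have := bval_near (crit_base m1) (fun k => U01 k t'01) d01 h.
  by rewrite -!/(crit _ _); lra.
by apply: upper_frakM yE => //; lra.
Qed.

End CriticalAlphabets.

Section Dimension.
Context {R : realType}.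
Implicit Types (m r s t x : R) (d : nat -> R) (E : set R) (n k N p q : nat).

Local Notation upper t := (@upper_word R t).
Local Notation lower1 t := (shift 1 (@lower_word R t)).

Lemma mechanical_int t d k : mechanical t d -> series d k \is a Num.int.
Proof.
move=> [t01 [->|[t1 ->]]]; last by rewrite series_shift_lower ?intr_int//; lra.
by rewrite series_upper// rpredB ?intr_int ?rpred1.
Qed.

Lemma mechanical_balanced t d j k : mechanical t d ->
  j.+1%:R * series d k < k.+1%:R * (series d j + 1).
Proof.
move=> [t01 [->|[t1 ->]]]; first exact: upper_balanced.
by apply: lower_balanced; lra.
Qed.

(* The first N partial sums of a mechanical word are determined by the index q
   minimizing (series d q + 1) / (q + 1), the best upper approximation of the
   slope, and by p = series d q. *)
Definition cell N q p : set R := [set m : R | 1 < m /\ exists t d,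
  [/\ mechanical t d, crit d m = m - 1, series d q = p%:R &
      forall k, (k <= N)%N ->
        k.+1%:R * (series d q + 1) <= q.+1%:R * (series d k + 1)]].

Lemma cell_partial_sums N p q t t' d d' k : mechanical t d -> mechanical t' d' ->
  series d q = p%:R -> series d' q = p%:R ->
  (forall k, (k <= N)%N ->
    k.+1%:R * (series d' q + 1) <= q.+1%:R * (series d' k + 1)) ->
  (k <= N)%N -> series d k <= series d' k.
Proof.
move=> td td' dq d'q h kN; have := mechanical_balanced q k td.
rewrite dq -d'q => /lt_le_trans/(_ (h k kN)); rewrite ltr_pM2l//.
by rewrite int_num_lt ?lerD2r// ?rpredD ?rpred1// (mechanical_int _ td, mechanical_int _ td').
Qed.

Lemma cell_diam N q p m m' : cell N q p m -> cell N q p m' ->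
  `|m - m'| <= 2 ^- N.
Proof.
wlog mm' : m m' / m <= m'.
  move=> H cm cm'; have [|/ltW] := leP m m'; first by move=> /H; apply.
  by rewrite distrC => /H; apply.
move=> [m1 [t [d [td dE dq h]]]] [m'1 [t' [d' [td' d'E d'q h']]]].
have d01 k := mechanical_unit k td. have d'01 k := mechanical_unit k td'.
rewrite distrC ger0_norm ?subr_ge0//.
have b1 := crit_base (ltW m1).
have := @bval_le_near _ _ b1 _ _ d'01 d01 N
  (fun k => cell_partial_sums td' td d'q dq h).
have := crit_antitone d'01 (ltW m1) mm'.
rewrite -!/(crit _ _) addrAC subrr add0r.
have := ler_wsqrtr (ltW m1); rewrite sqrtr1 => s1.
have : (Num.sqrt m)^-1 * (1 + Num.sqrt m) ^- N <= 2 ^- N.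
  rewrite -[leRHS]mul1r ler_pM ?invr_ge0 ?exprn_ge0 ?invf_le1 ?addr_ge0 ?sqrtr_ge0//; first lra.
  rewrite lef_pV2 ?posrE ?exprn_gt0//; try lra.
  by rewrite lerXn2r ?nnegrE; lra.
lra.
Qed.

Lemma frakM_cell N m : frakM R m ->
  exists q p, [/\ (q <= N)%N, (p <= N)%N & cell N q p m].
Proof.
move=> Mm; have [m12 _] := (frakMP m).1 Mm; have [t [d [td dE]]] := frakM_slope Mm.
pose F (i : 'I_N.+1) := (series d i + 1) / i.+1%:R.
case: (@arg_minP _ _ _ ord0 predT F isT) => i _ iP.
have /natrP[p pE] : series d i \is a Num.nat.
  rewrite natrEint (mechanical_int _ td)/=.
  by rewrite /series/= sumr_ge0// => k _; case/andP: (mechanical_unit k td).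
exists i, p; split; first exact: leq_ord.
  rewrite -(ler_nat R) -pE; apply: le_trans (_ : i%:R <= _); last by rewrite ler_nat leq_ord.
  rewrite /series/= -[leRHS](_ : \sum_(0 <= k < i) 1 = _).
    by apply: ler_sum => k _; case/andP: (mechanical_unit k td).
  by rewrite sumr_const_nat subn0.
split; first lra.
exists t, d; split => // k kN; have := iP (Ordinal (kN : (k < N.+1)%N)) isT.
by rewrite /F/= ler_pdivrMr// mulrAC ler_pdivlMr// mulrC [leRHS]mulrC.
Qed.

Local Open Scope ereal_scope.

Lemma diameter_ge0 E : 0 <= diameter E.
Proof. by rewrite /diameter le_max lexx. Qed.

Lemma diameter_le E r : (0 <= r)%R ->
  (forall x y, E x -> E y -> (`|x - y| <= r)%R) -> diameter E <= r%:E.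
Proof.
move=> r0 h; rewrite /diameter ge_max lee_fin r0/=; apply: ge_ereal_sup.
by move=> _ [x Ex [y Ey <-]]; rewrite lee_fin h.
Qed.

Lemma hausdorff_content_le s (c r : R) n E (U : nat -> set R) : (0 < s)%R ->
  (0 <= r <= c)%R ->
  E `<=` \bigcup_(i in `I_n) U i -> (forall i x y, U i x -> U i y -> (`|x - y| <= r)%R) ->
  hausdorff_content s c E <= (n%:R * r `^ s)%:E.
Proof.
move=> s0 /andP[r0 rc] EU Ur.
pose V i := if (i < n)%N then U i else set0.
have V0 i : (n <= i)%N -> diameter (V i) = 0.
  move=> ni; rewrite /V ltnNge ni/= /diameter.
  apply/eqP; rewrite eq_le le_max lexx/= andbT ge_max lexx/=.
  by apply: ge_ereal_sup => _ [x []].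
have Vr i : diameter (V i) <= r%:E.
  by rewrite /V; case: ifP => _; apply: diameter_le => // x y; exact: Ur.
apply: le_trans (_ : \sum_(0 <= i <oo) poweR (diameter (V i)) s <= _).
  apply: ereal_inf_lbound; exists V => //; split=> [x /EU[i /= ni Ux]|i].
    by exists i => //; rewrite /V ni.
  by apply: le_trans (Vr i) _; rewrite lee_fin.
rewrite (@nneseries_split _ _ 0 n); last by move=> *; exact: poweR_ge0.
rewrite add0n [X in _ + X]eseries0 ?adde0; last first.
  by move=> i ni _; rewrite V0// poweR0r// gt_eqF.
apply: le_trans (_ : \sum_(0 <= i < n) (r `^ s)%:E <= _).
  apply: lee_sum => i _; rewrite -poweR_EFin.
  by apply: (gt0_ler_poweR (ltW s0)) => //; rewrite in_itv/= leey andbT ?diameter_ge0 ?lee_fin.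
by rewrite sumEFin lee_fin sumr_const_nat subn0 mulr_natl.
Qed.

Lemma hausdorff_content_ge0 s (c : R) E : 0 <= hausdorff_content s c E.
Proof.
apply: le_ereal_inf_tmp => _ [U _ <-]; apply: nneseries_ge0 => *; exact: poweR_ge0.
Qed.

Local Close Scope ereal_scope.

Lemma frakM_content_le s (c : R) N : 0 < s -> 2 ^- N <= c ->
  (hausdorff_content s c (frakM R) <= ((N.+1 * N.+1)%N%:R * (2 ^- N) `^ s)%:E)%E.
Proof.
move=> s0 cN.
apply: (@hausdorff_content_le _ _ _ _ _ (fun i => cell N (i %/ N.+1) (i %% N.+1))) => //.
- by rewrite cN invr_ge0 exprn_ge0.
- move=> m /(frakM_cell N)[q [p [qN pN cm]]]; exists (q * N.+1 + p)%N => /=.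
    by rewrite -ltnS in qN; rewrite -ltnS in pN; nia.
  by rewrite divnMDl// modnMDl divn_small ?modn_small// addn0.
- by move=> i x y; exact: cell_diam.
Qed.

(* By Bernoulli, (N + 1) z ^ N is bounded. *)
Lemma polynomial_times_geometric z e : 0 < z < 1 -> 0 < e -> forall K, exists2 N,
  (K <= N)%N & (N.+1 * N.+1)%N%:R * (z ^+ 4) ^+ N < e :> R.
Proof.
move=> z01 e0 K; pose u := z^-1 - 1.
have u0 : 0 < u by rewrite subr_gt0 invf_gt1; lra.
have zu : z * (1 + u) = 1 by rewrite /u addrCA subrr addr0 divff// gt_eqF//; lra.
have B N : (1 + N%:R * u) * z ^+ N <= 1.
  elim: N => [|N IH]; first by rewrite mul0r addr0 mulr1.
  have zN : 0 <= z ^+ N by rewrite exprn_ge0//; lra.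
  have -> : (1 + N.+1%:R * u) * z ^+ N.+1 =
      ((1 + N%:R * u) * (z * (1 + u)) - N%:R * u * u * z) * z ^+ N.
    by rewrite exprS -natr1; ring.
  rewrite zu mulr1 mulrBl.
  suff : 0 <= N%:R * u * u * z * z ^+ N by lra.
  by rewrite !mulr_ge0//; lra.
pose C := 1 + u^-1.
have C0 : 0 < C by rewrite addr_gt0 ?invr_gt0.
have CB N : N.+1%:R * z ^+ N <= C.
  apply: le_trans (_ : C * ((1 + N%:R * u) * z ^+ N) <= _); last by rewrite ger_pMr.
  rewrite mulrA ler_wpM2r ?exprn_ge0//; first lra.
  have -> : C * (1 + N%:R * u) = N.+1%:R + (N%:R * u + u^-1).
    by rewrite /C -natr1; field; rewrite gt_eqF.
  by rewrite lerDl addr_ge0 ?mulr_ge0 ?invr_ge0// ltW.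
have z1 : `|z| < 1 by rewrite ger0_norm; lra.
have /cvgr0Pnorm_lt/(_ e e0)[M _ hM] := @cvg_geometric R (C ^+ 2) z z1.
exists (maxn K M); first exact: leq_maxl.
move: (maxn K M) (leq_maxr K M) => N /hM/=; apply: le_lt_trans.
rewrite /geometric ger0_norm; last by rewrite mulr_ge0 ?exprn_ge0//; lra.
have zN0 : 0 <= z ^+ N by rewrite exprn_ge0//; lra.
have zN1 : z ^+ N <= 1 by rewrite exprn_ile1//; lra.
have -> : (N.+1 * N.+1)%:R * z ^+ 4 ^+ N =
    (N.+1%:R * z ^+ N) ^+ 2 * (z ^+ N * z ^+ N).
  by rewrite natrM -exprM mulnC exprM; ring.
apply: ler_pM; rewrite ?exprn_ge0 ?mulr_ge0//.
  by rewrite lerXn2r// nnegrE ?mulr_ge0// ltW.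
by rewrite ler_piMl.
Qed.

Lemma frakM_measure0 s : 0 < s -> hausdorff_measure s (frakM R) = 0%E.
Proof.
move=> s0; pose z : R := (2^-1) `^ (s / 4).
have z01 : 0 < z < 1.
  have half : 0 < 2^-1 :> R by rewrite invr_gt0.
  have : (2^-1) `^ (s / 4) < 1 `^ (s / 4) :> R.
    by apply: gt0_ltr_powR; rewrite ?nnegrE//; lra.
  by rewrite powR1 powR_gt0.
have zE N : (2 ^- N) `^ s = (z ^+ 4) ^+ N :> R.
  have half : 0 <= 2^-1 :> R by rewrite invr_ge0.
  rewrite -exprVn -(powR_mulrn N half) -powRrM -exprM.
  rewrite -(powR_mulrn _ (powR_ge0 _ _)) -powRrM natrM.
  by congr (_ `^ _); field.
apply/eqP; rewrite eq_le; apply/andP; split; last first.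
  apply: le_trans (hausdorff_content_ge0 s 1 _) _.
  by apply: ereal_sup_ubound; exists 1 => //=.
apply: ge_ereal_sup => _ [c /= c0 <-]; apply/lee_addgt0Pr => e e0; rewrite add0e.
have /cvgr0Pnorm_lt/(_ c c0)[K _ hK] := @cvg_exprV_exp R 2 1 ltac:(lra).
have [N KN hN] := polynomial_times_geometric z01 e0 K.
apply: le_trans (@frakM_content_le s c N s0 _) _; last first.
  by rewrite lee_fin zE ltW.
have := hK N KN; rewrite /= mul1r ger0_norm; first exact: ltW.
by rewrite invr_ge0 exprn_ge0.
Qed.

Lemma frakM_dimension : hausdorff_dimension (frakM R) = 0%E.
Proof.
apply/eqP; rewrite eq_le; apply/andP; split.
  apply/lee_addgt0Pr => e e0; rewrite add0e; apply: ereal_inf_lbound.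
  by exists e => //; split => //; exact: frakM_measure0.
by apply: le_ereal_inf_tmp => _ [s [s0 _] <-]; rewrite lee_fin ltW.
Qed.

End Dimension.

Theorem theorem3 (R : realType) :
  [/\ ~ countable (frakM R),
      cantor_set_in [set m : R | 1 < m <= 2] (frakM R) &
      hausdorff_dimension (frakM R) = 0%E].
Proof.
split; [exact: frakM_uncountable| |exact: frakM_dimension].
split; [exact: frakM_closed|exact: frakM_interior|exact: frakM_isolated].
Qed.
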